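(* A delta-matroid is a Higgs lift delta-matroid if and only if it has no minor isomorphic to any of $U_1,U_2,\ldots,U_7$.
   Context: A set system is a pair $S=(E,\mathcal{F})$ with $E$ a finite set and $\mathcal{F}$ a collection of subsets of $E$ (feasible sets); it is proper if $\mathcal{F}\neq\emptyset$. Set systems $(E,\mathcal{F})$, $(E',\mathcal{F}')$ are isomorphic if there is a bijection $\phi:E\to E'$ with $A\in\mathcal{F}\iff\phi(A)\in\mathcal{F}'$ for all $A\subseteq E$. For proper $S$ and $e\in E$: $e$ is a loop if no feasible set contains $e$, a coloop if every feasible set contains $e$. If $e$ is not a loop, $S/e=(E-e,\{F-e: e\in F\in\mathcal{F}\})$; if $e$ is not a coloop, $S\backslash e=(E-e,\{F\in\mathcal{F}: e\notin F\})$; if $e$ is a loop or coloop, $S/e$ and $S\backslash e$ are both set equal to whichever of these was defined. A minor of $S$ is any set system obtained from $S$ by a (possibly empty) sequence of single-element deletions and contractions. A delta-matroid is a proper set system $(E,\mathcal{F})$ such that for all $X,Y\in\mathcal{F}$ and $u\in X\triangle Y$ there is $v\in X\triangle Y$ (possibly $v=u$) with $X\triangle\{u,v\}\in\mathcal{F}$. For matroids $Q,L$ on $E$, $Q$ is a quotient of $L$ if there is a matroid $M$ and $X\subseteq E(M)$ with $M\backslash X=L$, $M/X=Q$. For such $Q,L$ and $0\le i\le k:=r(L)-r(Q)$, the Higgs lift $H^i_{Q,L}$ is the matroid on $E$ with rank function $r_i(X)=\min\{r_Q(X)+i,r_L(X)\}$; its bases are the sets of size $r(Q)+i$ containing a basis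 of $Q$ and contained in a basis of $L$. A delta-matroid $D=(E,\mathcal{F})$ is a Higgs lift delta-matroid if there are matroids $Q,L$ on $E$ with $Q$ a quotient of $L$ and a set $K\subseteq\{0,\ldots,k\}$ such that $\{0,\ldots,k\}-K$ contains no two consecutive integers and $\mathcal{F}=\bigcup_{i\in K}\mathcal{B}(H^i_{Q,L})$. The set systems: $U_1=(\{a,b\},\{\emptyset,\{a\},\{a,b\}\})$; $U_2=(\{a,b,c\},\{\emptyset,\{c\},\{a,b\},\{a,b,c\}\})$; for $3\le i\le 7$, $U_i$ has ground set $E=\{a,b,c,d\}$ and feasible sets $\emptyset$, $E$, and the following 2-element sets: $U_3$: $\{a,b\},\{c,d\}$; $U_4$: $\{a,b\},\{b,c\},\{c,d\}$; $U_5$: $\{a,b\},\{b,c\},\{c,d\},\{a,d\}$; $U_6$: $\{a,b\},\{b,c\},\{a,c\},\{a,d\}$; $U_7$: $\{a,b\},\{b,c\},\{a,c\},\{c,d\},\{a,d\}$. *)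

(* Defs.v *)
From mathcomp Require Import all_boot.

Set Implicit Arguments.
Unset Strict Implicit.
Unset Printing Implicit Defensive.

(* A set system whose ground set is a subset of the ambient type [T], so that
   deletion and contraction stay within the type [setsys T]. *)
Record setsys (T : finType) := SetSys {
  ground : {set T};
  feasible : {set {set T}};
  feasible_sub : feasible \subset powerset ground
}.

Definition proper_sys (T : finType) (S : setsys T) : Prop :=
  feasible S != set0.

(* The bijection lives on the subtypes carried by the ground sets, so that no
   condition is put on the elements of [T] and [T'] outside of them. *)
Definition isomorphic (T T' : finType) (S : setsys T) (S' : setsys T') : Prop :=
  exists2 phi : {x : T | x \in ground S} -> {y : T' | y \in ground S'},
    bijective phi &
    forall A : {set {x : T | x \in ground S}},
      (val @: A \in feasible S) <-> (val @: (phi @: A) \in feasible S').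

Section Minors.
Variable T : finType.
Implicit Types (S : setsys T) (e : T).

Definition loop S e : bool := [forall F in feasible S, e \notin F].
Definition coloop S e : bool := [forall F in feasible S, e \in F].

Lemma avoid_sub S e :
  [set F in feasible S | e \notin F] \subset powerset (ground S :\ e).
Proof.
apply/subsetP => F; rewrite inE powersetE => /andP[FS eF].
by rewrite subsetD1 eF -powersetE (subsetP (feasible_sub S)).
Qed.

Lemma through_sub S e :
  [set F :\ e | F in feasible S & e \in F] \subset powerset (ground S :\ e).
Proof.
apply/subsetP => _ /imsetP[F + ->]; rewrite inE powersetE => /andP[FS _].
by rewrite setSD // -powersetE (subsetP (feasible_sub S)).
Qed.

Definition avoid S e : setsys T := SetSys (avoid_sub S e).
Definition through S e : setsys T := SetSys (through_sub S e).

Definition delete S e : setsys T := if coloop S e then through S e else avoid S e.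
Definition contract S e : setsys T := if loop S e then avoid S e else through S e.

Inductive minor S : setsys T -> Prop :=
| minor_refl : minor S S
| minor_delete S' e : minor S S' -> e \in ground S' -> minor S (delete S' e)
| minor_contract S' e : minor S S' -> e \in ground S' -> minor S (contract S' e).

End Minors.

Definition has_minor_iso (T T' : finType) (S : setsys T) (U : setsys T') : Prop :=
  exists2 S', minor S S' & isomorphic S' U.

Definition symdiff (T : finType) (A B : {set T}) : {set T} :=
  (A :\: B) :|: (B :\: A).

Definition delta_matroid (T : finType) (S : setsys T) : Prop :=
  proper_sys S /\
  forall X Y : {set T}, X \in feasible S -> Y \in feasible S ->
  forall u, u \in symdiff X Y ->
  exists2 v, v \in symdiff X Y & symdiff X [set u; v] \in feasible S.

(* A matroid is represented by the set system of its bases. *)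
Definition matroid (T : finType) (M : setsys T) : Prop :=
  proper_sys M /\
  forall A B : {set T}, A \in feasible M -> B \in feasible M ->
  forall x, x \in A :\: B ->
  exists2 y, y \in B :\: A & y |: (A :\ x) \in feasible M.

Section MatroidOperations.
Variable T : finType.
Implicit Types (M Q L : setsys T) (X : {set T}).

Definition indep M X : bool := [exists B in feasible M, X \subset B].

Definition rank_in M X : nat :=
  \max_(I : {set T} | (I \subset X) && indep M I) #|I|.

Definition mrank M : nat := rank_in M (ground M).

Lemma maxset_sub (E : {set T}) (P : pred {set T}) :
  [set B | maxset (fun I => (I \subset E) && P I) B] \subset powerset E.
Proof.
by apply/subsetP => B; rewrite inE powersetE => /maxsetp/andP[].
Qed.

(* The independent sets of [M \ X] are those of [M] that avoid [X]. *)
Definition mdelete M X : setsys T := SetSys (maxset_sub (ground M :\: X) (indep M)).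

Lemma mdual_sub M :
  [set ground M :\: B | B in feasible M] \subset powerset (ground M).
Proof. by apply/subsetP => _ /imsetP[B _ ->]; rewrite powersetE subsetDl. Qed.

Definition mdual M : setsys T := SetSys (mdual_sub M).

Definition mcontract M X : setsys T := mdual (mdelete (mdual M) X).

(* The matroid on [E] with rank function [r]: its independent sets are the [I]
   with [r I = #|I|]. *)
Definition matroid_of_rank (E : {set T}) (r : {set T} -> nat) : setsys T :=
  SetSys (maxset_sub E (fun I => r I == #|I|)).

Definition higgs_lift Q L (i : nat) : setsys T :=
  matroid_of_rank (ground L) (fun X => minn (rank_in Q X + i) (rank_in L X)).

End MatroidOperations.

Lemma relabel_sub (T T' : finType) (f : T -> T') (S : setsys T) :
  [set f @: F | F : {set T} in feasible S] \subset powerset (f @: ground S).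
Proof.
apply/subsetP => _ /imsetP[F FS ->]; rewrite powersetE imsetS //.
by rewrite -powersetE (subsetP (feasible_sub S)).
Qed.

Definition relabel (T T' : finType) (f : T -> T') (S : setsys T) : setsys T' :=
  SetSys (relabel_sub f S).

(* [M] may need more elements than the ambient type [T] of [Q] and [L] has, so
   it lives on a type [T'] into which [T] embeds. *)
Definition quotient (T : finType) (Q L : setsys T) : Prop :=
  exists (T' : finType) (f : T -> T') (M : setsys T') (X : {set T'}),
    [/\ injective f, matroid M, X \subset ground M,
        mdelete M X = relabel f L & mcontract M X = relabel f Q].

Definition higgs_lift_delta_matroid (T : finType) (D : setsys T) : Prop :=
  delta_matroid D /\
  exists Q L : setsys T,
    [/\ matroid Q /\ ground Q = ground D,
        matroid L /\ ground L = ground D,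
        quotient Q L &
        exists K : {set 'I_(mrank L - mrank Q).+1},
          (forall i j : 'I_(mrank L - mrank Q).+1,
             nat_of_ord j = i.+1 -> i \in K \/ j \in K) /\
          feasible D = \bigcup_(i in K) feasible (higgs_lift Q L i)].

Definition a : 'I_4 := @Ordinal 4 0 isT.
Definition b : 'I_4 := @Ordinal 4 1 isT.
Definition c : 'I_4 := @Ordinal 4 2 isT.
Definition d : 'I_4 := @Ordinal 4 3 isT.

Lemma U1_sub :
  [set set0; [set a]; [set a; b]] \subset powerset [set a; b].
Proof.
apply/subsetP => A; rewrite !inE => /orP[/orP[]|] /eqP->;
  by apply/subsetP => x; rewrite !inE // => ->.
Qed.

Lemma U2_sub :
  [set set0; [set c]; [set a; b]; [set a; b; c]] \subset powerset [set a; b; c].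
Proof.
apply/subsetP => A; rewrite !inE => /orP[/orP[/orP[]|]|] /eqP->;
  by apply/subsetP => x; rewrite !inE // => ->; rewrite ?orbT.
Qed.

Lemma full_sub (T : finType) (F : {set {set T}}) : F \subset powerset [set: T].
Proof. by apply/subsetP => A _; rewrite powersetE subsetT. Qed.

Definition U1 : setsys 'I_4 := SetSys U1_sub.
Definition U2 : setsys 'I_4 := SetSys U2_sub.

(* [[set: 'I_4]] is the set of [a], [b], [c] and [d]. *)
Definition U3 : setsys 'I_4 := SetSys (full_sub
  [set set0; setT; [set a; b]; [set c; d]]).
Definition U4 : setsys 'I_4 := SetSys (full_sub
  [set set0; setT; [set a; b]; [set b; c]; [set c; d]]).
Definition U5 : setsys 'I_4 := SetSys (full_sub
  [set set0; setT; [set a; b]; [set b; c]; [set c; d]; [set a; d]]).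
Definition U6 : setsys 'I_4 := SetSys (full_sub
  [set set0; setT; [set a; b]; [set b; c]; [set a; c]; [set a; d]]).
Definition U7 : setsys 'I_4 := SetSys (full_sub
  [set set0; setT; [set a; b]; [set b; c]; [set a; c]; [set c; d]; [set a; d]]).

(* Main.v *)
Require Import Defs.
From mathcomp Require Import all_boot.
From mathcomp Require Import zify.

(* Let [G] be the family of feasible sets of a delta-matroid, and call a set
   between if it contains a feasible set and is contained in one. With [Q] and
   [L] the matroids of the smallest and of the largest feasible sets, the bases of
   the [i]-th Higgs lift of [Q] towards [L] are the between sets of size
   [r(Q) + i]. Hence the delta-matroid is a Higgs lift delta-matroid iff [G] is
   level closed: a between set is feasible as soon as some feasible set has its
   size. Level closure passes to minors and fails for [U1], ..., [U7].
   Conversely, if it fails then, the between sets of a given size forming a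
   matroid, some feasible [B + z] and infeasible between [B + x] differ by one
   exchange. Exchanging [z] (resp. [x]) out of (resp. into) [B + z] gives feasible
   sets [X] and [Y] with [X \subset B], [B + x + z \subset Y] and
   [#|Y :\: X| <= 4]; the minor on [Y :\: X] contains some [U_i]. *)

Set Implicit Arguments.
Unset Strict Implicit.
Unset Printing Implicit Defensive.

(** * Feasible sets and between sets *)

Section Families.
Variable T : finType.
Implicit Types (G : {set {set T}}) (A B F H X Y Z : {set T}).

(** The obstacle is that a between set is spanning and extendable by two unrelated witnesses, and a
    swap that respects one may destroy the other. [parity] couples them: a weight that is odd at a
    single element forces either a small feasible set without it or a large one with it. Both
    exchange among between sets and the description of the bases of a Higgs lift rest on this. The
    index set [K] of a Higgs lift delta-matroid may omit both end levels, so the given [Q] and [L]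
    need not be the matroids of its own smallest and largest feasible sets. For that direction the
    family is replaced by the traces of the bases of the matroid that witnesses the quotient. The
    bound 4 arises because [X] is [B] or [B - w] and [Y] is [B + x + z] or [B + x + z + y]. A
    feasible singleton or triple in the resulting 4-cube leads back to a smaller cube. Otherwise the
    feasible 2-sets form a graph on four vertices; exchange at the bottom forbids isolated vertices,
    exchange at the top forbids a vertex on all edges. Besides the complete graph, which has no
    infeasible pair, the graphs left are two disjoint edges, the path, the 4-cycle, the triangle
    with a pendant edge and the complete graph minus an edge: [U3] to [U7]. *)

Lemma in_symdiff A B x : (x \in symdiff A B) = (x \in A) (+) (x \in B).
Proof. by rewrite !inE; case: (x \in A); case: (x \in B). Qed.

Definition exchange G : Prop :=
  forall X Y, X \in G -> Y \in G -> forall u, u \in symdiff X Y ->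
  exists2 v, v \in symdiff X Y & symdiff X [set u; v] \in G.

Definition score (w : T -> nat) (s F : {set T}) : nat :=
  \sum_v ((v \in F) == (v \in s)) * w v.

(** Flipping [u] gains [w u], and flipping [v] loses at most [w v]; for [v = u] there is only the
    gain. *)
Lemma score_flip w (s F : {set T}) u v :
    (u \in F) != (u \in s) -> w v <= w u ->
  score w s F <= score w s (symdiff F [set u; v]).
Proof.
move=> Fu wvu; rewrite /score (bigD1 u) //= [leqRHS](bigD1 u) //=.
rewrite in_symdiff !inE eqxx addbT (negPf Fu) mul0n add0n.
have -> : (~~ (u \in F) == (u \in s)) by case: (u \in F) (u \in s) Fu => [] [].
rewrite mul1n; case: (eqVneq v u) => [->|vu].
  apply: leq_trans (leq_addl _ _); apply: eq_leq; apply: eq_bigr => x xu.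
  by rewrite in_symdiff !inE (negPf xu) addbF.
rewrite (bigD1 v) //= [X in _ <= _ + X](bigD1 v) //= addnA.
apply: leq_add; last first.
  apply: eq_leq; apply: eq_bigr => x /andP[xu xv].
  by rewrite in_symdiff !inE (negPf xu) (negPf xv) addbF.
by apply: leq_trans (leq_addr _ _); apply: leq_trans wvu; case: eqP; rewrite ?mul1n.
Qed.

(* The greedy algorithm may treat the elements of maximal weight first, and
   match as many of them as some feasible set does. *)
Lemma greedy G w (s U : {set T}) X F :
    exchange G -> X \in G -> {in U, forall u, (u \in X) = (u \in s)} ->
    (forall u v, u \in U -> w v <= w u) -> F \in G ->
  exists F', [/\ F' \in G, {in U, forall u, (u \in F') = (u \in s)} &
                 score w s F <= score w s F'].
Proof.
move=> exG XG Xs wU; have [n] := ubnP #|U :&: symdiff F s|.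
elim: n F => // n IHn F ltFn FG.
have [UF|[u]] := set_0Vmem (U :&: symdiff F s).
  exists F; split=> // u uU; move/setP/(_ u): UF.
  by rewrite in_setI in_set0 in_symdiff uU; case: (u \in F) (u \in s) => [] [].
move=> /[dup] uUF /setIP[uU]; rewrite in_symdiff => Fu.
(* [X] agrees with [s] on [U]. Hence if the partner [v] lies in [U], then [F] disagrees with [s] at
   [v] too, and the flip repairs [v] instead of spoiling it. *)
have [|v] := exG F X FG XG u; first by rewrite in_symdiff Xs.
rewrite in_symdiff => Fv F1G.
have [||F' [F'G F's le_F']] := IHn (symdiff F [set u; v]); last 1 first.
- exists F'; split=> //; apply: leq_trans le_F'; apply: score_flip; last exact: wU.
  by case: (u \in F) (u \in s) Fu => [] [].
- rewrite -ltnS; apply: leq_trans ltFn; rewrite ltnS; apply/proper_card/properP; split.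
    apply/subsetP=> x /setIP[xU]; rewrite in_setI !in_symdiff in_set2 xU => xF1.
    have [xv|xv] := eqVneq x v; first by move: Fv; rewrite -xv Xs.
    move: xF1; rewrite (negPf xv) orbF; case: eqVneq => [->|] //.
    by rewrite addbF.
  exists u => //; rewrite inE in_symdiff in_symdiff !inE eqxx uU /=.
  by case: (u \in F) (u \in s) Fu => [] [].
- exact: F1G.
Qed.

(* With weight 2 on [P :|: N] and weight 1 on [y], the maximal score is reached
   both by a set avoiding [N] and by a set containing [P]; its parity then tells
   whether [y] belongs to these sets. *)
Lemma parity G (P N : {set T}) y X Y :
    exchange G -> X \in G -> Y \in G -> [disjoint X & N] -> P \subset Y ->
    [disjoint P & N] -> y \notin P -> y \notin N ->
  (exists F, [/\ F \in G, [disjoint F & N] & y \notin F]) \/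
  (exists2 F, F \in G & y |: P \subset F).
Proof.
move=> exG XG YG XN PY PN yP yN.
pose w v := if v \in P :|: N then 2 else (v == y) : nat.
have wle u v : u \in P :|: N -> w v <= w u.
  by move=> uPN; rewrite /w uPN; case: ifP => // _; case: (v == y).
have oddw F : odd (score w P F) = (y \notin F).
  rewrite /score (bigD1 y) //= oddD /w inE (negPf yP) (negPf yN) /= eqxx muln1.
  rewrite oddb eqbF_neg -[RHS]addbF; congr (_ (+) _); apply/negbTE.
  apply: (big_ind (fun n => ~~ odd n)) => // [m n|v vy].
    by rewrite oddD => /negPf-> /negPf->.
  by rewrite (negPf vy) oddM; case: ifP; rewrite ?andbF.
case: (@arg_maxnP _ X (fun F => F \in G) (score w P) XG) => F0 F0G F0max.
have [||F1 [F1G F1N le1]] := greedy (w := w) (s := P) (U := N) exG XG _ _ F0G.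
- by move=> u uN; rewrite (disjointFl XN uN) (disjointFl PN uN).
- by move=> u v uN; apply: wle; rewrite inE uN orbT.
have [||F2 [F2G F2P le2]] := greedy (w := w) (s := P) (U := P) exG YG _ _ F0G.
- by move=> u uP; rewrite (subsetP PY) ?uP.
- by move=> u v uP; apply: wle; rewrite inE uP.
have E : score w P F1 = score w P F2.
  by apply/eqP; rewrite eqn_leq (leq_trans (F0max _ F1G)) // (leq_trans (F0max _ F2G)).
have [yF1|yF1] := boolP (y \in F1); last first.
  left; exists F1; split=> //; rewrite disjoint_sym disjoint_subset.
  by apply/subsetP=> v vN; rewrite inE F1N // (disjointFl PN vN).
right; exists F2 => //; rewrite subUset sub1set.
rewrite -[y \in F2]negbK -oddw -E oddw yF1 /=.
by apply/subsetP=> v vP; rewrite F2P.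
Qed.

(** Greedy choice towards the empty set with constant weights: avoiding [~: F] can be given priority
    because [F] itself avoids it, and [X] provides the bound. *)
Lemma exists_subset_small G X F :
  exchange G -> X \in G -> F \in G -> exists F', [/\ F' \in G, F' \subset F & #|F'| <= #|X|].
Proof.
move=> exG XG FG.
have [||F' [F'G F'F le_X]] := greedy (w := fun=> 1) (s := set0) (U := ~: F) exG FG _ _ XG => //.
- by move=> u; rewrite !inE => /negPf.
exists F'; split=> //.
  by rewrite -setCS; apply/subsetP=> u uF; rewrite inE F'F // inE.
have S (H : {set T}) : score (fun=> 1) set0 H = #|~: H|.
  by rewrite /score -sum1_card [RHS]big_mkcond; apply: eq_bigr => v _; rewrite !inE; case: (v \in H).
by move: le_X; rewrite !S; have := cardsC X; have := cardsC F'; lia.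
Qed.

Lemma score_setT (H R : {set T}) : score (fun v => v \in R) setT H = #|H :&: R|.
Proof.
rewrite /score -sum1_card [RHS]big_mkcond; apply: eq_bigr => v _; rewrite !inE.
by case: (v \in H); case: (v \in R).
Qed.

(** Sizes are compared inside [S] only, the weight being the indicator of [S]. The inclusion of [R]
    in [S] gives the elements of [R] maximal weight, so that they may be treated first. *)
Lemma exists_superset_large G X F (R : {set T}) :
    exchange G -> X \in G -> F \in G -> R \subset F ->
  forall S : {set T}, R \subset S ->
  exists F', [/\ F' \in G, R \subset F' & #|X :&: S| <= #|F' :&: S|].
Proof.
move=> exG XG FG RF S RS.
have [||F' [F'G F'F le_X]] :=
  greedy (w := fun v => v \in S) (s := setT) (U := R) exG FG _ _ XG => //.
- by move=> u uR; rewrite inE (subsetP RF).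
- by move=> u v uR; rewrite (subsetP RS u uR); case: (v \in S).
exists F'; split=> //; last by rewrite -!score_setT.
by apply/subsetP=> u uR; rewrite F'F // inE.
Qed.

Definition spanning G A := [exists X in G, X \subset A].
Definition extendable G A := [exists Y in G, A \subset Y].
Definition between G A := spanning G A && extendable G A.

Lemma spanningP G A : reflect (exists2 X, X \in G & X \subset A) (spanning G A).
Proof. exact: exists_inP. Qed.

Lemma extendableP G A : reflect (exists2 Y, Y \in G & A \subset Y) (extendable G A).
Proof. exact: exists_inP. Qed.

Lemma mem_between G A : A \in G -> between G A.
Proof. by move=> AG; apply/andP; split; apply/exists_inP; exists A. Qed.

Lemma spanningS G A B : A \subset B -> spanning G A -> spanning G B.
Proof.
by move=> AB /spanningP[X XG XA]; apply/spanningP; exists X => //; apply: subset_trans AB.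
Qed.

Lemma extendableS G A B : A \subset B -> extendable G B -> extendable G A.
Proof.
by move=> AB /extendableP[X XG XA]; apply/extendableP; exists X => //; apply: subset_trans XA.
Qed.

(** A feasible set that contains [F] and at least [#|H|] elements of [F :|: H] must contain an
    element of [H :\: F]; this is why the size is measured inside [F :|: H]. *)
Lemma extendable_augment G F H :
    exchange G -> extendable G F -> extendable G H -> #|F| < #|H| ->
  exists2 y, y \in H :\: F & extendable G (y |: F).
Proof.
move=> exG /extendableP[Y1 Y1G FY1] /extendableP[Y2 Y2G HY2] ltFH.
have [Y [YG FY leY]] := exists_superset_large exG Y2G Y1G FY1 (subsetUl F H).
have [YF|[y /setDP[/setIP[yY /setUP[yF|yH]] yNF]]] := set_0Vmem ((Y :&: (F :|: H)) :\: F).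
- have := subset_leq_card (_ : Y :&: (F :|: H) \subset F).
  rewrite -setD_eq0 YF eqxx => /(_ isT).
  have : #|H| <= #|Y2 :&: (F :|: H)|.
    by apply: subset_leq_card; rewrite subsetI HY2 subsetUr.
  lia.
- by rewrite yF in yNF.
exists y; first by rewrite inE yNF.
by apply/extendableP; exists Y => //; rewrite subUset sub1set yY.
Qed.

Lemma between_augment G F H :
    exchange G -> between G F -> between G H -> #|F| < #|H| ->
  exists2 y, y \in H :\: F & between G (y |: F).
Proof.
move=> exG /andP[sF eF] /andP[_ eH] lt.
have [y yHF e] := extendable_augment exG eF eH lt.
by exists y => //; rewrite /between e (spanningS _ sF) // subsetUr.
Qed.

Lemma between_exchange G F H x :
    exchange G -> between G F -> between G H -> x \in F :\: H ->
  between G (F :\ x) \/ exists2 y, y \in H :\: F & between G (y |: F :\ x).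
Proof.
move=> exG /andP[/spanningP[X XG XF] /extendableP[Y YG FY]] /andP[/spanningP[X' X'G X'H] _].
case/setDP=> xF xH.
have [sFx|nsFx] := boolP (spanning G (F :\ x)).
  left; rewrite /between sFx; apply/extendableP; exists Y => //.
  by apply: subset_trans FY; apply: subsetDl.
right; have noS F' : F' \in G -> ~~ (F' \subset F :\ x).
  by move=> F'G; apply: contra nsFx => ?; apply/spanningP; exists F'.
have xX : x \in X.
  by apply: contraR (noS X XG) => xX; rewrite subsetD1 XF.
have xX' : x \notin X' by apply: contra xH; apply: (subsetP X'H).
have [|v] := exG X X' XG X'G x; first by rewrite in_symdiff xX (negPf xX').
rewrite in_symdiff => Xv X1G.
have vX : v \notin X.
  apply: contra (noS _ X1G) => vX; apply/subsetP=> t; rewrite in_symdiff !inE.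
  case: (eqVneq t x) => [->|tx] /=; first by rewrite xX.
  case: (eqVneq t v) => [->|tv]; rewrite ?vX //= addbF.
  exact: (subsetP XF).
rewrite (negPf vX) /= in Xv.
have X1E : symdiff X [set x; v] = v |: X :\ x.
  apply/setP=> t; rewrite in_symdiff !inE.
  case: (eqVneq t v) => [->|tv]; first by rewrite (negPf vX) orbT.
  by rewrite orbF; case: (eqVneq t x) => [->|]; rewrite ?xX //= addbF.
rewrite X1E in X1G.
have vx : v != x by apply: contraNneq xX' => <-.
have vF : v \notin F.
  apply: contra (noS _ X1G) => vF; rewrite subUset sub1set !inE vF vx /=.
  exact: setSD.
have vH : v \in H by apply: (subsetP X'H).
exists v; first by rewrite inE vF.
have s1 : v |: X :\ x \subset v |: F :\ x by apply/setUS/setSD.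
apply/andP; split; first by apply/spanningP; exists (v |: X :\ x).
(* So far [v |: F :\ x] is only known to be spanning. A feasible set inside it that avoids [v] would
   lie in [F :\ x], which is not spanning; the other outcome of [parity] is a feasible set above
   it. *)
have [|||||[F' [F'G F'N vF']]|[F' F'G sF']] :=
  @parity G (F :\ x) (~: (v |: F :\ x)) v _ _ exG X1G YG.
- by rewrite disjoints_subset setCK.
- by apply: subset_trans FY; apply: subsetDl.
- by rewrite disjoints_subset setCK subsetUr.
- by rewrite !inE (negPf vF) andbF.
- by rewrite !inE eqxx.
- case/negP: (noS _ F'G); move: F'N; rewrite disjoints_subset setCK => /subsetP F's.
  apply/subsetP=> t tF'; have := F's t tF'; rewrite !inE; case: eqP => // tv.
  by rewrite -tv tF' in vF'.
by apply/extendableP; exists F'.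
Qed.

(** If removing [x] already leaves a between set, that set is smaller than [H], and augmenting it
    from [H] restores the size; the new element is not [x], as [x] is outside [H]. *)
Lemma between_exchange_le G F H x :
    exchange G -> between G F -> between G H -> #|F| <= #|H| -> x \in F :\: H ->
  exists2 y, y \in H :\: F & between G (y |: F :\ x).
Proof.
move=> exG bF bH le xFH; have [bFx|] := between_exchange exG bF bH xFH => //.
case/setDP: xFH => xF xH.
have [|y /setDP[yH]] := between_augment exG bFx bH.
  by move: le; rewrite (cardsD1 x F) xF.
rewrite !inE negb_and negbK => /orP[/eqP yx|yF] by_; first by rewrite -yx yH in xH.
by exists y => //; rewrite inE yF.
Qed.

Definition level_closed G : Prop :=
  forall A Z, between G A -> Z \in G -> #|Z| = #|A| -> A \in G.

(** Exchanges lead from [Z] to [A] through between sets of one size. The walk starts at a feasible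
    set and would end at an infeasible one, so some step leaves [G]. *)
Lemma adjacent_obstruction G A Z :
    exchange G -> between G A -> Z \in G -> #|Z| = #|A| -> A \notin G ->
  exists Z' z a, [/\ Z' \in G, z \in Z', a \notin Z',
                     between G (a |: Z' :\ z) & a |: Z' :\ z \notin G].
Proof.
move=> exG bA ZG ZA AG; have [n] := ubnP #|Z :\: A|.
elim: n Z ZG ZA => // n IHn Z ZG ZA lt.
have [ZA0|[z zZA]] := set_0Vmem (Z :\: A).
  have /eqP E : Z == A by rewrite eqEcard ZA leqnn andbT -setD_eq0 ZA0.
  by rewrite -E ZG in AG.
have [|y yAZ bZ] := between_exchange_le exG (mem_between ZG) bA _ zZA; first by rewrite ZA.
case/setDP: (zZA) (yAZ) => zZ zA /setDP[yA yZ].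
have [Z1G|Z1G] := boolP (y |: Z :\ z \in G); last by exists Z, z, y.
apply: (IHn _ Z1G).
  by rewrite cardsU1 !inE (negPf yZ) andbF -ZA [in RHS](cardsD1 z) zZ.
rewrite -ltnS; apply: leq_trans lt; rewrite ltnS; apply/proper_card/properP; split.
  apply/subsetP=> t; rewrite !inE => /andP[tA].
  by case: eqP => [ty|_ /andP[_ ->]]; [rewrite ty yA in tA | rewrite tA].
by exists z => //; rewrite !inE eqxx /= orbF (negPf zA) /=; apply: contraNneq zA => ->.
Qed.

End Families.

(** * Higgs lifts of the smallest and largest feasible sets *)

Section Ranks.
Variable T : finType.
Implicit Types (M : setsys T) (G : {set {set T}}) (B F I X Y : {set T}).

Lemma feasible_ground M B : B \in feasible M -> B \subset ground M.
Proof. by move/(subsetP (feasible_sub M)); rewrite powersetE. Qed.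

Lemma setsys_eq M M' : ground M = ground M' -> feasible M = feasible M' -> M = M'.
Proof.
case: M M' => [E F s] [E' F' s'] /= EE FF; move: s s'; rewrite EE FF => s s'.
by congr SetSys; apply: bool_irrelevance.
Qed.

Lemma leq_rank_in M B X : B \in feasible M -> #|B :&: X| <= rank_in M X.
Proof.
move=> BM; rewrite /rank_in (bigmax_sup (B :&: X)) //=.
by rewrite subsetIr; apply/exists_inP; exists B; rewrite ?subsetIl.
Qed.

Lemma rank_in_attained M X :
  proper_sys M -> exists2 B, B \in feasible M & rank_in M X = #|B :&: X|.
Proof.
case/set0Pn=> B0 B0M; pose P I := (I \subset X) && indep M I.
have [|I /andP[IX /exists_inP[B BM IB]] rX] := @eq_bigmax_cond _ P (fun I : {set T} => #|I|).
  apply/card_gt0P; exists set0; rewrite unfold_in /P sub0set.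
  by apply/exists_inP; exists B0; rewrite ?sub0set.
exists B => //; apply/eqP; rewrite eqn_leq leq_rank_in // andbT.
by rewrite /rank_in rX subset_leq_card // subsetI IB.
Qed.

Definition smallest (G : {set {set T}}) := [set X in G | [forall Y in G, #|X| <= #|Y|]].
Definition largest (G : {set {set T}}) := [set Y in G | [forall X in G, #|X| <= #|Y|]].

Lemma smallestP G X :
  reflect (X \in G /\ forall Y, Y \in G -> #|X| <= #|Y|) (X \in smallest G).
Proof. by rewrite inE; apply: (iffP andP) => -[XG /forall_inP]. Qed.

Lemma largestP G X :
  reflect (X \in G /\ forall Y, Y \in G -> #|Y| <= #|X|) (X \in largest G).
Proof. by rewrite inE; apply: (iffP andP) => -[XG /forall_inP]. Qed.

Lemma smallest_neq0 G : G != set0 -> smallest G != set0.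
Proof.
case/set0Pn=> X XG; apply/set0Pn.
case: (@arg_minnP _ X (fun F => F \in G) (fun F : {set T} => #|F|) XG) => F FG Fmin.
by exists F; apply/smallestP.
Qed.

Lemma largest_neq0 G : G != set0 -> largest G != set0.
Proof.
case/set0Pn=> X XG; apply/set0Pn.
case: (@arg_maxnP _ X (fun F => F \in G) (fun F : {set T} => #|F|) XG) => F FG Fmax.
by exists F; apply/largestP.
Qed.

Lemma spanning_smallest G F :
  exchange G -> spanning G F -> exists2 X, X \in smallest G & X \subset F.
Proof.
move=> exG /spanningP[Y YG YF].
have /smallest_neq0/set0Pn[X0 /smallestP[X0G X0min]] : G != set0 by apply/set0Pn; exists Y.
have [X [XG XY leX]] := exists_subset_small exG X0G YG.
exists X; last exact: subset_trans YF.
by apply/smallestP; split=> // Z ZG; apply: leq_trans (X0min _ ZG).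
Qed.

Lemma extendable_largest G F :
  exchange G -> extendable G F -> exists2 Y, Y \in largest G & F \subset Y.
Proof.
move=> exG /extendableP[X XG FX].
have /largest_neq0/set0Pn[Y0 /largestP[Y0G Y0max]] : G != set0 by apply/set0Pn; exists X.
have [Y [YG FY]] := exists_superset_large exG Y0G XG FX (subsetT F).
rewrite !setIT => leY; exists Y => //.
by apply/largestP; split=> // Z ZG; apply: leq_trans leY; apply: Y0max.
Qed.

Section HiggsLift.
Variables (G : {set {set T}}) (Q L : setsys T).
Hypotheses (exG : exchange G) (G0 : G != set0).
Hypotheses (fQ : feasible Q = smallest G) (fL : feasible L = largest G).

Let pQ : proper_sys Q. Proof. by rewrite /proper_sys fQ smallest_neq0. Qed.
Let pL : proper_sys L. Proof. by rewrite /proper_sys fL largest_neq0. Qed.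

Lemma mrank_smallest X : X \in smallest G -> mrank Q = #|X|.
Proof.
rewrite -fQ => XQ; have [B BQ E] := rank_in_attained (ground Q) pQ.
rewrite /mrank E (setIidPl (feasible_ground BQ)).
move: BQ XQ; rewrite fQ => /smallestP[BG Bmin] /smallestP[XG Xmin].
by apply/eqP; rewrite eqn_leq Bmin // Xmin.
Qed.

Lemma mrank_largest Y : Y \in largest G -> mrank L = #|Y|.
Proof.
rewrite -fL => YL; have [B BL E] := rank_in_attained (ground L) pL.
rewrite /mrank E (setIidPl (feasible_ground BL)).
move: BL YL; rewrite fL => /largestP[BG Bmax] /largestP[YG Ymax].
by apply/eqP; rewrite eqn_leq Ymax // Bmax.
Qed.

Lemma leq_mrank F : F \in G -> mrank Q <= #|F| <= mrank L.
Proof.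
move=> FG; have /set0Pn[X Xs] := smallest_neq0 G0; have /set0Pn[Y Yl] := largest_neq0 G0.
rewrite (mrank_smallest Xs) (mrank_largest Yl).
by case/smallestP: Xs => _ Xmin; case/largestP: Yl => _ Ymax; rewrite Xmin ?Ymax.
Qed.

Lemma leq_card_rank_largest I : (#|I| <= rank_in L I) = extendable G I.
Proof.
apply/idP/idP=> [le|/(extendable_largest exG)[Y]].
  have [B] := rank_in_attained I pL; rewrite fL => /largestP[BG _] E.
  apply/extendableP; exists B => //; rewrite setIC in E.
  by apply/setIidPl/eqP; rewrite eqEcard subsetIl -E.
rewrite -fL => YL IY; apply: leq_trans (leq_rank_in I YL).
by rewrite (setIidPr IY).
Qed.

Lemma rank_smallest_leq I : rank_in Q I <= mrank Q.
Proof.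
have [X] := rank_in_attained I pQ; rewrite fQ => Xs ->.
by rewrite (mrank_smallest Xs) subset_leq_card // subsetIl.
Qed.

Lemma higgs_lift_indep I i :
  (minn (rank_in Q I + i) (rank_in L I) == #|I|) =
  extendable G I && (#|I| <= rank_in Q I + i).
Proof.
rewrite -leq_card_rank_largest.
have : rank_in L I <= #|I|.
  by have [B _ ->] := rank_in_attained I pL; rewrite subset_leq_card // subsetIr.
by move=> leL; apply/idP/idP; lia.
Qed.

Lemma higgs_lift_feasible i :
    G \subset powerset (ground L) -> i <= mrank L - mrank Q ->
  feasible (higgs_lift Q L i) = [set F | between G F & #|F| == mrank Q + i].
Proof.
move=> /subsetP GE lei; apply/setP=> I; rewrite !inE.
apply/maxsetP/andP=> [[/andP[IE]]|[/andP[sI eI] /eqP cI]]; last first.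
  have [X Xs XI] := spanning_smallest exG sI.
  have rI : rank_in Q I = mrank Q.
    apply/eqP; rewrite eqn_leq rank_smallest_leq (mrank_smallest Xs).
    by rewrite -(setIidPl XI) leq_rank_in // fQ.
  split.
    rewrite higgs_lift_indep eI rI cI leqnn !andbT.
    case/extendableP: eI => Y /GE; rewrite powersetE => YE IY.
    exact: subset_trans YE.
  move=> H /andP[_]; rewrite higgs_lift_indep => /andP[_ leH] IH.
  apply/eqP; rewrite eq_sym eqEcard IH cI; apply: leq_trans leH _.
  by rewrite leq_add2r rank_smallest_leq.
rewrite higgs_lift_indep => /andP[eI leI] maxI.
(* Maximality of [I] in the form used below: no [y] can be added when the result is extendable and a
   basis of [Q] certifies the rank bound for it. *)
have noext y X : X \in smallest G -> y \notin I -> extendable G (y |: I) ->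
    #|I| < #|X :&: (y |: I)| + i -> False.
  move=> Xs yI eyI lt; suff /setP/(_ y) : y |: I = I by rewrite !inE eqxx (negPf yI).
  apply: maxI; last exact: subsetUr.
  rewrite higgs_lift_indep eyI cardsU1 yI add1n.
  rewrite (leq_trans lt) ?leq_add2r ?leq_rank_in ?fQ // !andbT.
  case/extendableP: eyI => Y /GE; rewrite powersetE => YE IY.
  exact: subset_trans YE.
have [X] := rank_in_attained I pQ; rewrite fQ => Xs rI.
have [XI|/subsetPn[y yX yI]] := boolP (X \subset I).
  have bI : between G I.
    by rewrite /between eI andbT; apply/spanningP; exists X => //; case/smallestP: Xs.
  split=> //; move: leI; rewrite rI (setIidPl XI) -(mrank_smallest Xs).
  rewrite leq_eqVlt => /orP[] // lt.
  (* If [I] were smaller than [mrank Q + i], it would be smaller than a largest feasible set, by the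
     bound on [i], and could be augmented from it. *)
  have /set0Pn[Y Yl] := largest_neq0 G0; have [YG _] := largestP _ _ Yl.
  have := leq_mrank YG; rewrite (mrank_largest Yl) => /andP[leQY _].
  rewrite (mrank_largest Yl) in lei.
  have [|y /setDP[_ yI] /andP[_ byI]] := between_augment exG bI (mem_between YG); first by lia.
  case: (noext y X Xs yI byI); rewrite (setIidPl _) -?(mrank_smallest Xs) //.
  by apply: subset_trans XI _; apply: subsetUr.
have /smallestP[XG _] := Xs.
have /extendableP[Y YG IY] := eI.
(* It must be excluded that [X], a basis of [Q] meeting [I] as much as possible, sticks out of [I]
   at [y]. A feasible set inside [I :|: X] without [y] contains a basis of [Q] that must meet [I] in
   more elements than [X] does. A feasible set above [y |: I] lets [I] grow, since [X] meets
   [y |: I] in one more element. *)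
have [||||[F [FG FN yF]]|[F FG sF]] := @parity T G I (~: (I :|: X)) y _ _ exG XG YG _ IY.
- by rewrite disjoints_subset setCK subsetUr.
- by rewrite disjoints_subset setCK subsetUl.
- by [].
- by rewrite !inE yX orbT.
- have [|F0 F0s F0F] := @spanning_smallest G F exG; first by apply/spanningP; exists F.
  have : #|F0 :&: I| <= #|X :&: I| by rewrite -rI leq_rank_in // fQ.
  have : #|F0 :\: I| <= #|(X :\: I) :\ y|.
    apply: subset_leq_card; apply/subsetP=> t /setDP[tF0 tI].
    have tF := subsetP F0F _ tF0; rewrite !inE tI /=.
    have -> /= : t != y by apply: contraNneq yF => <-.
    by move: FN; rewrite disjoints_subset setCK => /subsetP/(_ t tF); rewrite inE (negPf tI).
  have : #|F0| = #|X| by rewrite -!mrank_smallest.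
  have := cardsID I F0; have := cardsID I X; have := cardsD1 y (X :\: I).
  by rewrite !inE yX yI /=; clear; lia.
case: (noext y X Xs yI); first by apply/extendableP; exists F.
apply: leq_ltn_trans leI _; rewrite ltn_add2r rI; apply/proper_card/properP.
split; first by apply/setIS/subsetUr.
by exists y; rewrite !inE ?yX ?eqxx ?(negPf yI).
Qed.

End HiggsLift.
End Ranks.

(** * The smallest feasible sets form a quotient of the largest ones *)

Section SumSets.
Variables (T K : finType).
Implicit Types (A B : {set T + K}) (F : {set T}) (S : {set K}).

Definition linl B : {set T} := [set x | inl x \in B].
Definition linr B : {set K} := [set j | inr j \in B].

Lemma linl_imset F : linl (inl @: F) = F.
Proof. by apply/setP=> x; rewrite inE mem_imset //; apply: inl_inj. Qed.

Lemma linlU A B : linl (A :|: B) = linl A :|: linl B.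
Proof. by apply/setP=> x; rewrite !inE. Qed.

Lemma linl_inr S : linl (inr @: S) = set0.
Proof. by apply/setP=> x; rewrite !inE; apply/imsetP; case. Qed.

Lemma linlS A B : A \subset B -> linl A \subset linl B.
Proof. by move/subsetP=> AB; apply/subsetP=> x; rewrite !inE; apply: AB. Qed.

Lemma imset_linl B F : B \subset inl @: F -> B = inl @: linl B.
Proof.
move/subsetP=> BF; apply/setP=> x; apply/idP/imsetP=> [xB|[y + ->]]; last by rewrite inE.
by have /imsetP[y _ E] := BF x xB; exists y; rewrite // inE -E.
Qed.

Lemma linl_sub B F S : B \subset inl @: F :|: inr @: S -> linl B \subset F.
Proof. by move/linlS; rewrite linlU linl_imset linl_inr setU0. Qed.

Lemma disjoint_inl_inr F S : [disjoint inl @: F & inr @: S].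
Proof.
rewrite -setI_eq0; apply/eqP/setP=> x; rewrite !inE.
by apply/andP=> -[/imsetP[y _ ->] /imsetP[]].
Qed.

Lemma card_inl_inr F S : #|(inl @: F :|: inr @: S) : {set T + K}| = #|F| + #|S|.
Proof.
rewrite -(card_imset (mem F) (@inl_inj T K)) -(card_imset (mem S) (@inr_inj T K)).
by rewrite cardsU disjoint_setI0 ?disjoint_inl_inr // cards0 subn0.
Qed.

Lemma sum_setE B : B = inl @: linl B :|: inr @: linr B.
Proof.
apply/setP=> -[x|j]; rewrite inE mem_imset ?inE; try exact: inl_inj; try exact: inr_inj.
  by case: imsetP => [[]|] //; rewrite orbF.
by case: imsetP => [[]|].
Qed.

Lemma card_sum_set B : #|B| = #|linl B| + #|linr B|.
Proof. by rewrite {1}[B]sum_setE card_inl_inr. Qed.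

End SumSets.

Section Quotient.
Variables (T : finType) (G : {set {set T}}) (Q L : setsys T) (E : {set T}).
Implicit Types (F X Y : {set T}).
Hypotheses (exG : exchange G) (G0 : G != set0) (GE : G \subset powerset E).
Hypotheses (fQ : feasible Q = smallest G) (fL : feasible L = largest G).
Hypotheses (gQ : ground Q = E) (gL : ground L = E).

Lemma between_smallest F : spanning G F -> #|F| = mrank Q -> F \in smallest G.
Proof.
case/(spanning_smallest exG) => X Xs XF cF.
suff -> : F = X by [].
by apply/eqP; rewrite eq_sym eqEcard XF cF (mrank_smallest G0 fQ Xs) /=.
Qed.

Lemma between_largest F : extendable G F -> #|F| = mrank L -> F \in largest G.
Proof.
case/(extendable_largest exG) => Y Yl FY cF.
suff -> : F = Y by [].
by apply/eqP; rewrite eqEcard FY cF (mrank_largest G0 fL Yl) /=.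
Qed.

Lemma matroid_smallest : matroid Q.
Proof.
split=> [|A B]; first by rewrite /proper_sys fQ smallest_neq0.
rewrite fQ => As Bs x xAB.
have [AG BG] : A \in G /\ B \in G by case/smallestP: As; case/smallestP: Bs.
have [|y /setDP[yB yA] /andP[s _]] :=
    between_exchange_le exG (mem_between AG) (mem_between BG) _ xAB.
  by rewrite -!(mrank_smallest G0 fQ).
exists y; first by rewrite inE yA.
apply: between_smallest s _; case/setDP: xAB => xA _.
by rewrite cardsU1 !inE (negPf yA) andbF (mrank_smallest G0 fQ As) (cardsD1 x A) xA.
Qed.

Lemma matroid_largest : matroid L.
Proof.
split=> [|A B]; first by rewrite /proper_sys fL largest_neq0.
rewrite fL => Al Bl x xAB.
have [AG BG] : A \in G /\ B \in G by case/largestP: Al; case/largestP: Bl.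
have [|y /setDP[yB yA] /andP[_ e]] :=
    between_exchange_le exG (mem_between AG) (mem_between BG) _ xAB.
  by rewrite -!(mrank_largest G0 fL).
exists y; first by rewrite inE yA.
apply: between_largest e _; case/setDP: xAB => xA _.
by rewrite cardsU1 !inE (negPf yA) andbF (mrank_largest G0 fL Al) (cardsD1 x A) xA.
Qed.

Let k := mrank L - mrank Q.
Let K : {set T + 'I_k} := inr @: [set: 'I_k].
Let big : {set T + 'I_k} := inl @: E :|: K.

Lemma extendable_sub F : extendable G F -> F \subset E.
Proof.
case/extendableP=> Y /(subsetP GE); rewrite powersetE => YE FY.
exact: subset_trans YE.
Qed.

(* The bases of the matroid on [E + 'I_k] whose restriction to [E] is [L] and
   whose contraction to [E] is [Q]. *)
Definition lift_bases : {set {set T + 'I_k}} :=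
  [set B : {set T + 'I_k} | (#|B| == mrank L) && between G (linl B)].

Lemma lift_bases_sub : lift_bases \subset powerset big.
Proof.
apply/subsetP=> B; rewrite inE powersetE => /and3P[_ _ /extendable_sub BE].
apply/subsetP=> -[x|j] xB; rewrite inE; apply/orP; [left|right]; last first.
  by apply: imset_f; rewrite inE.
by apply: imset_f; apply: (subsetP BE); rewrite inE.
Qed.

Definition lift_matroid : setsys (T + 'I_k)%type := SetSys lift_bases_sub.

(** The elements of ['I_k] are interchangeable fillers that [linl] ignores. An exchange either
    happens among between sets, or swaps two fillers, or trades an element of [linl A] for a filler,
    or replaces a filler by an element that augments [linl A]; comparing the sizes of the two parts
    of [A] and [B] shows which of these is available. *)
Lemma lift_matroidP : matroid lift_matroid.
Proof.
split.
  have /set0Pn[Y Yl] := largest_neq0 G0; apply/set0Pn; exists (inl @: Y).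
  rewrite inE card_imset; last exact: inl_inj.
  by rewrite linl_imset (mrank_largest G0 fL Yl) eqxx mem_between //; case/largestP: Yl.
move=> A B; rewrite !inE => /andP[/eqP cA bA] /andP[/eqP cB bB] x xAB.
suff [y yBA by_] : exists2 y, y \in B :\: A & between G (linl (y |: A :\ x)).
  exists y => //; rewrite inE by_ andbT; case/setDP: yBA xAB => yB yA /setDP[xA xB].
  by rewrite cardsU1 !inE (negPf yA) andbF -cA (cardsD1 x A) xA.
have inlD y z : linl (inl y |: A :\ inl z) = y |: linl A :\ z.
  by apply/setP=> t; rewrite !inE -!(inj_eq (@inl_inj T 'I_k)).
have leAB : #|linl A| + #|linr A| = #|linl B| + #|linr B|.
  by rewrite -!card_sum_set cA.
case: x xAB => [x|j] xAB.
  have xAB' : x \in linl A :\: linl B by move: xAB; rewrite !inE.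
  have [le|lt] := leqP #|linl A| #|linl B|.
    have [y yBA by_] := between_exchange_le exG bA bB le xAB'.
    by exists (inl y); [move: yBA; rewrite !inE | rewrite inlD].
  have [bAx|[y yBA by_]] := between_exchange exG bA bB xAB'; last first.
    by exists (inl y); [move: yBA; rewrite !inE | rewrite inlD].
  have [j jB jA] : exists2 j, j \in linr B & j \notin linr A.
    by apply/subsetPn; apply: contraL lt => /subset_leq_card; lia.
  exists (inr j); first by move: jA jB; rewrite !inE => -> ->.
  suff -> : linl (inr j |: A :\ inl x) = linl A :\ x by [].
  by apply/setP=> t; rewrite !inE -!(inj_eq (@inl_inj T 'I_k)).
have [BA|/subsetPn[i]] := boolP (linr B \subset linr A); last first.
  rewrite !inE => iB iA; exists (inr i); first by rewrite !inE iB iA.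
  suff -> : linl (inr i |: A :\ inr j) = linl A by [].
  by apply/setP=> t; rewrite !inE.
have [|y yBA by_] := between_augment exG bA bB.
  have : linr B \proper linr A.
    by apply/properP; split=> //; exists j; move: xAB; rewrite !inE => /andP[].
  by move/proper_card; lia.
exists (inl y); first by move: yBA; rewrite !inE.
suff -> : linl (inl y |: A :\ inr j) = y |: linl A by [].
by apply/setP=> t; rewrite !inE -!(inj_eq (@inl_inj T 'I_k)).
Qed.

Lemma lift_indep F : indep lift_matroid (inl @: F) = extendable G F.
Proof.
apply/exists_inP/idP=> [[B]|].
  rewrite inE => /and3P[_ _ eB] /linlS; rewrite linl_imset => FB.
  exact: extendableS eB.
case/(extendable_largest exG)=> Y Yl FY; exists (inl @: Y); last exact: imsetS.
rewrite inE card_imset; last exact: inl_inj.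
by rewrite linl_imset (mrank_largest G0 fL Yl) eqxx mem_between //; case/largestP: Yl.
Qed.

Lemma mrank_addk : mrank Q + k = mrank L.
Proof.
have /set0Pn[X XG] := G0; have := leq_mrank G0 fQ fL XG; rewrite /k; lia.
Qed.

Lemma lift_coindep F :
  indep (mdual lift_matroid) (inl @: F) = (F \subset E) && spanning G (E :\: F).
Proof.
apply/exists_inP/andP=> [[_ /imsetP[B + ->]]|[FE]].
  rewrite inE => /and3P[_ sB /extendable_sub BE] /=.
  rewrite subsetD => /andP[/linl_sub]; rewrite linl_imset => FE dB.
  split=> //; apply: spanningS sB; rewrite subsetD BE disjoint_sym.
  rewrite disjoint_subset; apply/subsetP=> x xF; rewrite !inE.
  by rewrite (disjointFr dB) // imset_f.
case/(spanning_smallest exG)=> X Xs; rewrite subsetD => /andP[XE XF].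
(* The basis complemented here consists of a smallest feasible set and all [k] fillers, so that its
   size is [mrank Q + k = mrank L]. *)
exists (big :\: (inl @: X :|: K)).
  apply: imset_f; rewrite inE card_inl_inr cardsT card_ord -(mrank_smallest G0 fQ Xs).
  rewrite mrank_addk eqxx linlU linl_imset linl_inr setU0 mem_between //.
  by case/smallestP: Xs.
rewrite subsetD; apply/andP; split.
  by apply: subset_trans (subsetUl _ _); apply: imsetS.
rewrite disjoint_sym disjoints_subset subUset -!disjoints_subset; apply/andP; split.
  rewrite -setI_eq0 -imsetI; last by move=> ? ? _ _; apply: inl_inj.
  by rewrite (disjoint_setI0 XF) imset0.
by rewrite disjoint_sym disjoint_inl_inr.
Qed.

Lemma big_setD : big :\: K = inl @: E.
Proof.
by rewrite setDUl setDv setU0; apply/setDidPl; apply: disjoint_inl_inr.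
Qed.

Lemma quotient_smallest_largest : quotient Q L.
Proof.
exists (T + 'I_k)%type, inl, lift_matroid, K; split.
- exact: inl_inj.
- exact: lift_matroidP.
- exact: subsetUr.
- apply: setsys_eq; first by rewrite /= big_setD gL.
  apply/setP=> I; rewrite /= big_setD inE fL; apply/maxsetP/imsetP.
    case=> /andP[/imset_linl E1]; rewrite {1}E1 lift_indep => eI maxI.
    have [Y Yl IY] := extendable_largest exG eI.
    have YG : Y \in G by case/largestP: Yl.
    exists Y => //; apply/esym/maxI; last by rewrite E1 imsetS.
    have [_ eY] := andP (mem_between YG).
    by rewrite lift_indep eY imsetS // extendable_sub.
  case=> Y Yl ->; have [YG Ymax] := largestP _ _ Yl.
  have [_ eY] := andP (mem_between YG).
  split=> [|H]; first by rewrite lift_indep eY imsetS // extendable_sub.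
  case/andP=> /imset_linl E1; rewrite {1}E1 lift_indep => eH YH.
  have {}YH : Y \subset linl H by rewrite -[Y](@linl_imset _ 'I_k) linlS.
  have [Z Zl HZ] := extendable_largest exG eH.
  have cZ : #|Z| = #|Y| by rewrite -!(mrank_largest G0 fL).
  rewrite E1; suff -> : linl H = Y by []; apply/eqP; rewrite eq_sym eqEcard YH -cZ.
  exact: subset_leq_card.
(* Contraction is deletion in the dual, so a basis of [Q] has to be recognized as the complement in
   [E] of a maximal coindependent set. *)
- apply: setsys_eq; first by rewrite /= big_setD gQ.
  apply/setP=> I; rewrite /= big_setD fQ.
  have inlD F : inl @: E :\: inl @: F = inl @: (E :\: F) :> {set T + 'I_k}.
    apply/setP=> -[x|j]; rewrite !inE ?mem_imset ?inE //; try exact: inl_inj.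
    by apply/andP/imsetP=> [[_ /imsetP[]]|[]].
  apply/imsetP/imsetP=> [[B]|[X Xs ->]].
    rewrite inE => /maxsetP[/andP[/imset_linl E1]].
    rewrite {1}E1 lift_coindep => /andP[BE sB] maxB ->.
    have [X Xs] := spanning_smallest exG sB; rewrite subsetD => /andP[XE XB].
    exists X => //; have XG : X \in G by case/smallestP: Xs.
    rewrite -(maxB (inl @: (E :\: X))).
    + by rewrite inlD setDDr setDv set0U (setIidPr XE).
    + rewrite lift_coindep subsetDl imsetS ?subsetDl //= setDDr setDv set0U.
      by rewrite (setIidPr XE); case/andP: (mem_between XG).
    + rewrite E1 imsetS // subsetD BE disjoint_sym //.
  have [XG Xmin] := smallestP _ _ Xs.
  have [sX /extendable_sub XE] := andP (mem_between XG).
  exists (inl @: (E :\: X)); last by rewrite inlD setDDr setDv set0U (setIidPr XE).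
  rewrite inE; apply/maxsetP; split.
    rewrite lift_coindep subsetDl imsetS ?subsetDl //= setDDr setDv set0U.
    by rewrite (setIidPr XE).
  move=> H /andP[/imset_linl E1]; rewrite {1}E1 lift_coindep => /andP[HE sH].
  move/linlS; rewrite linl_imset => XH; rewrite E1; suff -> : linl H = E :\: X by []; apply/eqP.
  rewrite eq_sym eqEcard XH /=.
  have [Z Zs ZH] := spanning_smallest exG sH.
  have cZ : #|Z| = #|X| by rewrite -!(mrank_smallest G0 fQ).
  have := subset_leq_card ZH; have := subset_leq_card HE; have := subset_leq_card XE.
  by rewrite !cardsD (setIidPr HE) (setIidPr XE); move: cZ; clear; lia.
Qed.

End Quotient.

(** * Higgs lift delta-matroids are the level closed ones *)

Section Characterization.
Variable T : finType.
Implicit Types (G : {set {set T}}) (D M : setsys T) (A B F X Y Z : {set T}).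

(** Among the feasible subsets of [Y] of size at most [n.+1], take a largest one. If its size were
    below [n], an exchange towards [Y] would add one or two elements and remove none, giving a
    larger one within the bound. This yields the condition that no two consecutive levels are
    missing from [K]. *)
Lemma no_gap G X Y n :
    exchange G -> X \in G -> Y \in G -> #|X| <= n < #|Y| ->
  exists2 F, F \in G & n <= #|F| <= n.+1.
Proof.
move=> exG XG YG /andP[leX ltY].
have [X' [X'G X'Y leX']] := exists_subset_small exG XG YG.
pose P F := [&& F \in G, F \subset Y & #|F| <= n.+1].
have PX' : P X' by rewrite /P X'G X'Y; move: leX leX'; clear; lia.
case: (@arg_maxnP _ X' P (fun F : {set T} => #|F|) PX') => F /and3P[FG FY leF] Fmax.
exists F => //; rewrite leF andbT leqNgt; apply/negP=> ltF.
have /subsetPn[u uY uF] : ~~ (Y \subset F).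
  by apply/negP=> /subset_leq_card; move: ltY ltF; clear; lia.
have [|v] := exG F Y FG YG u; first by rewrite in_symdiff uY (negPf uF).
rewrite in_symdiff => Fv FuvG.
have vY : v \in Y by apply: contraTT Fv => vY; rewrite (negPf vY) addbF; apply: contra vY; apply: (subsetP FY).
have vF : v \notin F by rewrite vY addbT in Fv.
have E : symdiff F [set u; v] = F :|: [set u; v].
  apply/setP=> t; rewrite in_symdiff !inE.
  case: (eqVneq t u) => [->|_] /=; first by rewrite (negPf uF).
  by case: (eqVneq t v) => [->|_]; rewrite ?(negPf vF) ?addbF ?orbF.
have c2 : #|F :|: [set u; v]| <= #|F| + 2.
  by have := cardsU F [set u; v]; have := cards2 u v; clear; case: (u != v) => /=; lia.
have : #|F :|: [set u; v]| <= #|F|.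
  apply: Fmax; rewrite /P -E FuvG E subUset FY subUset !sub1set uY vY /=.
  by move: c2 ltF; clear; lia.
rewrite leqNgt => /negP; apply; apply/proper_card/properP; split; first exact: subsetUl.
by exists u; rewrite // !inE eqxx orbT.
Qed.

Lemma smallest_sub D : smallest (feasible D) \subset powerset (ground D).
Proof. by apply/subsetP=> X /smallestP[/(subsetP (feasible_sub D))]. Qed.

Lemma largest_sub D : largest (feasible D) \subset powerset (ground D).
Proof. by apply/subsetP=> X /largestP[/(subsetP (feasible_sub D))]. Qed.

Lemma level_closed_higgs_lift D :
  delta_matroid D -> level_closed (feasible D) -> higgs_lift_delta_matroid D.
Proof.
move=> dmD lcD; split=> //; case: dmD => D0 exD.
pose Q := SetSys (smallest_sub D); pose L := SetSys (largest_sub D).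
exists Q, L; split.
- by split=> //; apply: (matroid_smallest exD D0).
- by split=> //; apply: (matroid_largest exD D0).
- exact: (quotient_smallest_largest exD D0 (feasible_sub D)).
have fH (i : 'I_(mrank L - mrank Q).+1) : feasible (higgs_lift Q L i) =
    [set F | between (feasible D) F & #|F| == mrank Q + i].
  by apply: higgs_lift_feasible; rewrite ?feasible_sub //= -ltnS.
exists [set i : 'I__ | [exists F in feasible D, #|F| == mrank Q + i]]; split.
  move=> i j ij; rewrite !inE.
  have /set0Pn[X Xs] := smallest_neq0 D0; have /set0Pn[Y Yl] := largest_neq0 D0.
  have rX : mrank Q = #|X| by apply: mrank_smallest Xs.
  have rY : mrank L = #|Y| by apply: mrank_largest Yl.
  have [||||F FD] := @no_gap (feasible D) X Y (mrank Q + i) => //.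
  - by case/smallestP: Xs.
  - by case/largestP: Yl.
  - by move: (ltn_ord j) rX rY; rewrite ij; move: (nat_of_ord i) => n; clear; lia.
  rewrite leq_eqVlt eq_sym => /andP[/orP[cF _|lt le]]; [left|right].
    by apply/exists_inP; exists F.
  by apply/exists_inP; exists F; rewrite // ij addnS eqn_leq le.
apply/setP=> A; apply/idP/bigcupP=> [AD|[i]]; last first.
  rewrite inE fH inE => /exists_inP[Z ZD /eqP cZ] /andP[bA /eqP cA].
  by apply: lcD bA ZD _; rewrite cZ cA.
have /andP[leQ leL] : mrank Q <= #|A| <= mrank L by apply: leq_mrank AD.
have lt : #|A| - mrank Q < (mrank L - mrank Q).+1 by rewrite ltnS leq_sub2r.
have cA : #|A| == mrank Q + (#|A| - mrank Q) by rewrite subnKC.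
exists (Ordinal lt); first by rewrite inE; apply/exists_inP; exists A.
by rewrite fH inE mem_between.
Qed.

Lemma matroid_card M A B : matroid M -> A \in feasible M -> B \in feasible M -> #|A| = #|B|.
Proof.
case=> _ exM AM BM; have [n] := ubnP #|A :\: B|; elim: n A AM => // n IHn A AM lt.
have [AB|[x xAB]] := set_0Vmem (A :\: B).
  have {}AB : A \subset B by rewrite -setD_eq0 AB.
  suff -> : A = B by [].
  apply/eqP; rewrite eqEsubset AB; apply/subsetP=> y yB.
  apply: contraT => yA; have [|x] := exM B A BM AM y; first by rewrite inE yA.
  by case/setDP=> xA; rewrite (subsetP AB).
have [y /setDP[yB yA] A'M] := exM A B AM BM x xAB; case/setDP: (xAB) => xA xB.
rewrite -(IHn _ A'M); first by rewrite cardsU1 !inE (negPf yA) andbF (cardsD1 x A) xA.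
rewrite -ltnS; apply: leq_trans lt; rewrite ltnS; apply/proper_card/properP; split.
  by apply/subsetP=> t; rewrite !inE; case: eqP => [->|]; [rewrite yB | case: (t \in B) (t == x) => [] []].
by exists x => //; rewrite !inE eqxx orbF xB /=; apply: contraNneq xB => ->.
Qed.

(** The axiom prescribes the element that leaves; here the entering one is prescribed. Among the
    bases through [y] between [A :&: B] and [A :|: B], one with fewest elements outside [y |: A] has
    none: otherwise exchanging such an element towards [A] would improve it. By equal cardinality it
    is [y |: A :\ x] for some [x], and the lower bound [A :&: B] puts [x] outside [B]. *)
Lemma matroid_coexchange M A B y :
    matroid M -> A \in feasible M -> B \in feasible M -> y \in B :\: A ->
  exists2 x, x \in A :\: B & y |: A :\ x \in feasible M.
Proof.
move=> mM AM BM /setDP[yB yA].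
pose P C := [&& C \in feasible M, A :&: B \subset C, C \subset A :|: B & y \in C].
have PB : P B by rewrite /P BM subsetIr subsetUr.
case: (@arg_minnP _ B P (fun C : {set T} => #|C :\: (y |: A)|) PB) => C /and4P[CM ABC CAB yC] Cmin.
have [CA|[c /setDP[cC]]] := set_0Vmem (C :\: (y |: A)); last first.
  rewrite !inE negb_or => /andP[cy cA].
  have [|z /setDP[zA zC] C'M] := mM.2 C A CM AM c; first by rewrite inE cA.
  suff : #|C :\: (y |: A)| <= #|(z |: C :\ c) :\: (y |: A)|.
    rewrite leqNgt => /negP[]; apply/proper_card/properP; split.
      apply/subsetP=> t; rewrite !inE; case: (eqVneq t z) => [->|_] /=; first by rewrite zA orbT.
      by case: (t == c); rewrite ?andbF.
    exists c; rewrite !inE (negPf cy) (negPf cA) ?cC //= eqxx orbF.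
    by apply: contraNneq cA => ->.
  apply: Cmin; rewrite /P C'M /=; apply/and3P; split.
  - apply/subsetP=> t tAB; have tC := subsetP ABC t tAB; rewrite !inE tC andbT.
    by case: (eqVneq t c) => [tc|]; rewrite ?orbT //; case/setIP: tAB; rewrite tc (negPf cA).
  - rewrite subUset sub1set inE zA /=; apply: subset_trans CAB; apply: subsetDl.
  - by rewrite !inE yC andbT [y == c]eq_sym (negPf cy) orbT.
have {}CA : C \subset y |: A by rewrite -setD_eq0 CA.
have cCA := matroid_card mM CM AM.
have /subsetPn[x xA xC] : ~~ (A \subset C).
  apply/negP=> sAC; have /eqP E : A == C by rewrite eqEcard sAC cCA leqnn.
  by rewrite E yC in yA.
exists x; first by rewrite inE xA andbT; apply: contra xC => xB; apply: (subsetP ABC); rewrite inE xA.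
suff <- : C = y |: A :\ x by [].
apply/eqP; rewrite eqEcard; apply/andP; split.
  apply/subsetP=> t tC; have := subsetP CA t tC; rewrite !inE.
  by have -> : t != x by apply: contraNneq xC => <-.
by rewrite cardsU1 !inE (negPf yA) andbF cCA (cardsD1 x A) xA.
Qed.

End Characterization.

(** * Traces of the bases of a matroid on a subset of its ground set *)

Section Restriction.
Variables (T T' : finType) (f : T -> T') (M : setsys T') (E : {set T}) (X : {set T'}).
Hypotheses (f_inj : injective f) (mM : matroid M) (EX : ground M :\: X = f @: E).
Implicit Types (A F Y : {set T}) (B : {set T'}).

(** This family satisfies the exchange axiom of delta-matroids. Its smallest members come from the
    bases of the contraction of [X] and its largest from those of the deletion of [X], so it links
    any quotient pair in the way [higgs_lift_feasible] requires. *)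
Definition restrictions : {set {set T}} := [set E :&: f @^-1: (B : {set T'}) | B in feasible M].

Lemma restrictionsP A :
  reflect (exists2 B, B \in feasible M & A = E :&: f @^-1: B) (A \in restrictions).
Proof. exact: imsetP. Qed.

Lemma restrictions_sub : restrictions \subset powerset E.
Proof. by apply/subsetP=> _ /restrictionsP[B _ ->]; rewrite powersetE subsetIl. Qed.

Lemma restrictions_neq0 : restrictions != set0.
Proof.
case: mM => /set0Pn[B BM] _; apply/set0Pn.
by exists (E :&: f @^-1: B); apply/restrictionsP; exists B.
Qed.

Lemma restrictions_swap (B : {set T'}) x y : f x \in B -> x \in E -> y \notin B ->
    y |: B :\ f x \in feasible M ->
  (E :&: f @^-1: B) :\ x \in restrictions \/
  exists v, [/\ y = f v, v \in E & v |: (E :&: f @^-1: B) :\ x \in restrictions].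
Proof.
move=> xB xE yB yM; have [/imsetP[v vE yv]|yE] := boolP (y \in f @: E).
  right; exists v; split=> //; apply/restrictionsP; exists (y |: B :\ f x) => //.
  apply/setP=> t; rewrite !inE yv !(inj_eq f_inj).
  by case: (eqVneq t v) => [->|]; rewrite ?vE //=; case: (t == x); rewrite ?andbF.
left; apply/restrictionsP; exists (y |: B :\ f x) => //.
apply/setP=> t; rewrite !inE !(inj_eq f_inj).
have [tE|] := boolP (t \in E); rewrite ?andbF //=.
by have -> : f t == y = false by apply: contraNF yE => /eqP<-; apply: imset_f.
Qed.

Lemma restrictions_coswap (B : {set T'}) x y : x \in E -> y \in B ->
    f x |: B :\ y \in feasible M ->
  x |: (E :&: f @^-1: B) \in restrictions \/
  exists v, [/\ y = f v, v \in E & x |: (E :&: f @^-1: B) :\ v \in restrictions].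
Proof.
move=> xE yB yM; have [/imsetP[v vE yv]|yE] := boolP (y \in f @: E).
  right; exists v; split=> //; apply/restrictionsP; exists (f x |: B :\ y) => //.
  apply/setP=> t; rewrite !inE yv !(inj_eq f_inj).
  by case: (eqVneq t x) => [->|]; rewrite ?xE //=; case: (t == v); rewrite ?andbF.
left; apply/restrictionsP; exists (f x |: B :\ y) => //.
apply/setP=> t; rewrite !inE !(inj_eq f_inj).
case: (eqVneq t x) => [->|_]; rewrite ?xE //=; have [tE|] := boolP (t \in E) => //=.
by have -> : f t == y = false by apply: contraNF yE => /eqP<-; apply: imset_f.
Qed.

(** If [u] has to leave the first trace, basis exchange in [M] applies; if it has to enter,
    [matroid_coexchange] does. When the partner found in [M] lies outside the image of [E], the
    trace changes at [u] alone and [v = u] is the answer. *)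
Lemma exchange_restrictions : exchange restrictions.
Proof.
move=> _ _ /restrictionsP[B1 B1M ->] /restrictionsP[B2 B2M ->] u.
rewrite in_symdiff !inE; have [uE|//] := boolP (u \in E) => /=.
have [u1|u1] := boolP (f u \in B1) => /= u2.
  have [|y /setDP[yB2 yB1] yM] := mM.2 B1 B2 B1M B2M (f u); first by rewrite inE u1 andbT.
  case: (restrictions_swap u1 uE yB1 yM) => [R|[v [yv vE R]]].
    exists u; first by rewrite in_symdiff !inE uE u1.
    suff -> : symdiff (E :&: f @^-1: B1) [set u; u] = (E :&: f @^-1: B1) :\ u by [].
    by apply/setP=> t; rewrite in_symdiff !inE orbb; case: (eqVneq t u) => [->|]; rewrite ?uE ?u1 ?addbF.
  have v1 : f v \notin B1 by rewrite -yv.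
  exists v; first by rewrite in_symdiff !inE vE -yv yB2 (negPf yB1).
  suff -> : symdiff (E :&: f @^-1: B1) [set u; v] = v |: (E :&: f @^-1: B1) :\ u by [].
  apply/setP=> t; rewrite in_symdiff !inE.
  case: (eqVneq t v) => [->|]; first by rewrite (negPf v1) andbF orbT.
  by case: (eqVneq t u) => [->|]; rewrite ?uE ?u1 ?addbF.
have [|y /setDP[yB1 yB2] yM] := matroid_coexchange mM B1M B2M (y := f u).
  by rewrite inE u1.
case: (restrictions_coswap uE yB1 yM) => [R|[v [yv vE R]]].
  exists u; first by rewrite in_symdiff !inE uE u2 (negPf u1).
  suff -> : symdiff (E :&: f @^-1: B1) [set u; u] = u |: (E :&: f @^-1: B1) by [].
  by apply/setP=> t; rewrite in_symdiff !inE orbb; case: (eqVneq t u) => [->|]; rewrite ?uE ?(negPf u1) ?addbF.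
have v1 : f v \in B1 by rewrite -yv.
exists v; first by rewrite in_symdiff !inE vE -yv yB1 (negPf yB2).
suff -> : symdiff (E :&: f @^-1: B1) [set u; v] = u |: (E :&: f @^-1: B1) :\ v by [].
apply/setP=> t; rewrite in_symdiff !inE.
case: (eqVneq t u) => [->|]; first by rewrite (negPf u1) andbF.
by case: (eqVneq t v) => [->|]; rewrite ?vE ?v1 ?addbF.
Qed.

Lemma imset_restriction (B : {set T'}) : f @: (E :&: f @^-1: B) = (f @: E) :&: B.
Proof.
apply/setP=> y; rewrite inE; apply/imsetP/andP.
  by case=> x; rewrite !inE => /andP[xE xB] ->; rewrite imset_f.
by case=> /imsetP[x xE ->] xB; exists x; rewrite // !inE xE.
Qed.

Lemma restriction_indep A : A \in restrictions -> indep M (f @: A).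
Proof.
case/restrictionsP=> B BM ->; apply/exists_inP; exists B => //.
by rewrite imset_restriction subsetIr.
Qed.

Lemma sub_restriction (H B : {set T'}) :
  H \subset f @: E -> H \subset B -> H \subset f @: (E :&: f @^-1: B).
Proof. by move=> HE HB; rewrite imset_restriction subsetI HE. Qed.

Lemma imset_sub_ground A : A \in restrictions -> f @: A \subset ground M :\: X.
Proof. by rewrite EX => /(subsetP restrictions_sub); rewrite powersetE; apply: imsetS. Qed.

Lemma relabel_inj (S : setsys T) F : (f @: F \in feasible (relabel f S)) = (F \in feasible S).
Proof.
apply/imsetP/idP=> [[F' F'S /(imset_inj f_inj)->] //|FS]; by exists F.
Qed.

Lemma feasible_mdelete L : mdelete M X = relabel f L -> feasible L = largest restrictions.
Proof.
move=> eL; apply/setP=> F; rewrite -relabel_inj -eL inE.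
have exR := exchange_restrictions.
apply/maxsetP/idP=> [[/andP[]]|Fl].
  rewrite {1}EX => FE /exists_inP[B BM FB] maxF.
  have eF : extendable restrictions F.
    apply/extendableP; exists (E :&: f @^-1: B); first by apply/restrictionsP; exists B.
    have /subsetP sF := sub_restriction FE FB; apply/subsetP=> t tF.
    by rewrite -(mem_imset _ _ f_inj) sF // imset_f.
  have [Y Yl FY] := extendable_largest exR eF; have [YR _] := largestP _ _ Yl.
  suff -> : F = Y by [].
  apply/(imset_inj f_inj)/esym/maxF; last exact: imsetS.
  by rewrite imset_sub_ground // restriction_indep.
have [FR Fmax] := largestP _ _ Fl; split; first by rewrite imset_sub_ground // restriction_indep.
move=> H /andP[]; rewrite EX => HE /exists_inP[B BM HB] FH.
apply/eqP; rewrite eq_sym eqEcard FH (card_imset _ f_inj).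
apply: leq_trans (subset_leq_card (sub_restriction HE HB)) _.
by rewrite (card_imset _ f_inj) Fmax //; apply/restrictionsP; exists B.
Qed.

Lemma restriction_coindep A :
  A \in restrictions -> indep (mdual M) (ground M :\: X :\: f @: A).
Proof.
case/restrictionsP=> B BM ->; apply/exists_inP; exists (ground M :\: B).
  exact: imset_f.
rewrite EX imset_restriction; apply/subsetP=> y; rewrite -EX !inE.
by case: (y \in ground M); case: (y \in X); case: (y \in B).
Qed.

Lemma feasible_mcontract Q : mcontract M X = relabel f Q -> feasible Q = smallest restrictions.
Proof.
move=> eQ; apply/setP=> F; rewrite -relabel_inj -eQ.
have exR := exchange_restrictions.
have disj (H B : {set T'}) : H \subset f @: E -> H \subset ground M :\: B ->
    H \subset f @: E :\: f @: (E :&: f @^-1: B).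
  move=> HE; rewrite subsetD => /andP[_ HB]; rewrite subsetD HE imset_restriction.
  by rewrite disjoint_sym; apply: disjointWl (subsetIr _ _) _; rewrite disjoint_sym.
apply/imsetP/idP=> [[H]|Fs].
  rewrite inE /= => /maxsetP[/andP[]].
  rewrite {1}EX => HE /exists_inP[_ /imsetP[B BM ->] HB] maxH FH.
  have sB : spanning restrictions (E :&: f @^-1: B).
    by apply/spanningP; exists (E :&: f @^-1: B) => //; apply/restrictionsP; exists B.
  have [Y Ys YB] := spanning_smallest exR sB; have [YR _] := smallestP _ _ Ys.
  suff -> : F = Y by [].
  apply: (imset_inj f_inj); rewrite FH -(maxH (ground M :\: X :\: f @: Y)).
  - by rewrite setDDr setDv set0U (setIidPr _) // imset_sub_ground.
  - by rewrite restriction_coindep // subsetDl.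
  rewrite EX; apply: subset_trans (disj _ _ HE HB) _.
  by apply/setDS/imsetS.
have [FR Fmin] := smallestP _ _ Fs.
exists (ground M :\: X :\: f @: F); last first.
  by rewrite /= setDDr setDv set0U (setIidPr _) // imset_sub_ground.
rewrite inE; apply/maxsetP; split; first by rewrite restriction_coindep // subsetDl.
move=> H /andP[]; rewrite /= EX => HE /exists_inP[_ /imsetP[B BM ->] HB] FH.
apply/eqP; rewrite eq_sym eqEcard FH.
apply: leq_trans (subset_leq_card (disj _ _ HE HB)) _.
have BR : E :&: f @^-1: B \in restrictions by apply/restrictionsP; exists B.
rewrite !cardsDS -?EX ?imset_sub_ground // leq_sub2l // !(card_imset _ f_inj).
exact: Fmin.
Qed.

End Restriction.

Lemma higgs_lift_level_closed (T : finType) (D : setsys T) :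
  higgs_lift_delta_matroid D -> level_closed (feasible D).
Proof.
case=> _ [Q [L [[mQ gQ] [mL gL] [T' [f [M [X [f_inj mM XM dL cQ]]]]] [K [_ fD]]]]].
have EX : ground M :\: X = f @: ground L by rewrite -[LHS]/(ground (mdelete M X)) dL.
(* The feasible sets of [D] cannot play this role: levels 0 and [k] may both be missing from [K],
   and then [Q] and [L] are not the matroids of its extreme feasible sets. *)
pose G := restrictions f M (ground L).
have exG : exchange G by apply: exchange_restrictions.
have fH (i : 'I_(mrank L - mrank Q).+1) :
    feasible (higgs_lift Q L i) = [set F | between G F & #|F| == mrank Q + i].
  apply: higgs_lift_feasible.
  - exact: exG.
  - exact: restrictions_neq0.
  - exact: feasible_mcontract cQ.
  - exact: feasible_mdelete dL.
  - exact: restrictions_sub.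
  - by rewrite -ltnS.
have bD A : A \in feasible D -> between G A.
  by rewrite fD => /bigcupP[i _]; rewrite fH inE => /andP[].
move=> A Z /andP[/spanningP[X0 /bD/andP[s _] XA] /extendableP[Y0 /bD/andP[_ e] AY]] + cA.
rewrite fD => /bigcupP[i iK]; rewrite fH inE cA => /andP[_ ci].
apply/bigcupP; exists i => //; rewrite fH inE ci andbT.
by rewrite /between (spanningS XA s) (extendableS AY e).
Qed.

(** * Minors and isomorphisms *)

Section MinorClosed.
Variable T : finType.
Implicit Types (S D : setsys T) (A F X Y Z : {set T}) (e : T).

Lemma in_avoid S e F : (F \in feasible (avoid S e)) = (F \in feasible S) && (e \notin F).
Proof. by rewrite inE. Qed.

Lemma in_through S e F :
  (F \in feasible (through S e)) = (e |: F \in feasible S) && (e \notin F).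
Proof.
apply/imsetP/andP=> [[H]|[FS eF]].
  by rewrite inE => /andP[HS eH] ->; rewrite setD1K // !inE eqxx.
by exists (e |: F); rewrite ?setU1K // inE FS setU11.
Qed.

Lemma level_closed_avoid S e :
  level_closed (feasible S) -> level_closed (feasible (avoid S e)).
Proof.
move=> lcS A Z /andP[/spanningP[X + XA] /extendableP[Y + AY]].
rewrite !in_avoid => /andP[XS eX] /andP[YS eY] /andP[ZS eZ] cA.
have eA : e \notin A by apply: contra eY; apply: (subsetP AY).
rewrite eA andbT; apply: lcS ZS cA; apply/andP; split.
  by apply/spanningP; exists X.
by apply/extendableP; exists Y.
Qed.

Lemma level_closed_through S e :
  level_closed (feasible S) -> level_closed (feasible (through S e)).
Proof.
move=> lcS A Z /andP[/spanningP[X + XA] /extendableP[Y + AY]].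
rewrite !in_through => /andP[XS eX] /andP[YS eY] /andP[ZS eZ] cA.
have eA : e \notin A by apply: contra eY; apply: (subsetP AY).
rewrite eA andbT; apply: lcS ZS _; last by rewrite !cardsU1 eA eZ cA.
apply/andP; split; first by apply/spanningP; exists (e |: X); rewrite ?setUS.
by apply/extendableP; exists (e |: Y); rewrite ?setUS.
Qed.

Lemma level_closed_minor D S :
  minor D S -> level_closed (feasible D) -> level_closed (feasible S).
Proof.
elim=> // S' e _ IH _ /IH lc; rewrite /delete /contract; case: ifP => _;
  by [apply: level_closed_avoid | apply: level_closed_through].
Qed.

(** The minor that contracts [X] and deletes everything outside [Y], recorded through its feasible
    sets, so that the order of the single steps disappears. *)
Definition minor_on D X Y : Prop :=
  exists S, [/\ minor D S, ground S = Y :\: X &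
    forall F, (F \in feasible S) = (F \subset Y :\: X) && (X :|: F \in feasible D)].

Lemma setU_setD_sub X Z : X \subset Z -> X :|: Z :\: X = Z.
Proof.
move=> XZ; apply/setP=> t; rewrite !inE.
by have [/(subsetP XZ)->|] := boolP (t \in X).
Qed.

Lemma minor_on_contract D X Y Z e :
    minor_on D X Y -> e \in Y :\: X -> Z \in feasible D ->
    X \subset Z -> Z \subset Y -> e \in Z -> minor_on D (e |: X) Y.
Proof.
case=> S [mS gS fS] eYX ZD XZ ZY eZ.
have nloop : loop S e = false.
  apply/negP=> /forall_inP/(_ (Z :\: X)); rewrite fS setSD //= setU_setD_sub // ZD !inE eZ.
  by case/setDP: eYX => _ -> /(_ isT).
have EYX : Y :\: (e |: X) = (Y :\: X) :\ e by rewrite setDDl setUC.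
exists (contract S e); split; first by apply: minor_contract; rewrite // gS.
  by rewrite /contract nloop /= gS EYX.
move=> F; rewrite /contract nloop in_through fS subUset sub1set eYX /=.
by rewrite setUCA setUA EYX subsetD1 andbAC.
Qed.

Lemma minor_on_delete D X Y Z e :
    minor_on D X Y -> e \in Y :\: X -> Z \in feasible D ->
    X \subset Z -> Z \subset Y -> e \notin Z -> minor_on D X (Y :\ e).
Proof.
case=> S [mS gS fS] eYX ZD XZ ZY eZ.
have ncoloop : coloop S e = false.
  apply/negP=> /forall_inP/(_ (Z :\: X)); rewrite fS setSD //= setU_setD_sub // ZD !inE (negPf eZ).
  by rewrite andbF => /(_ isT).
have EYX : (Y :\ e) :\: X = (Y :\: X) :\ e by rewrite !setDDl setUC.
exists (delete S e); split; first by apply: minor_delete; rewrite // gS.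
  by rewrite /delete ncoloop /= gS EYX.
move=> F; rewrite /delete ncoloop in_avoid fS EYX subsetD1.
by rewrite andbAC.
Qed.

(** Contract [X] first, then delete the complement of [Y]. The feasible set [X] shows that no
    element to be contracted is a loop, and [Y] that no element to be deleted is a coloop, so the
    exceptional clauses of the two operations never apply. *)
Lemma minor_on_feasible D X Y :
  X \in feasible D -> Y \in feasible D -> X \subset Y -> minor_on D X Y.
Proof.
move=> XD YD XY; have YE := feasible_ground YD; have XE := feasible_ground XD.
have mX X0 : X0 \subset X -> minor_on D X0 (ground D).
  have [n] := ubnP #|X0|; elim: n X0 => // n IHn X0 lt X0X.
  have [->|[e eX0]] := set_0Vmem X0.
    exists D; split; rewrite ?setD0 //; first exact: minor_refl.
    move=> F; rewrite set0U andbC.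
    by case FD: (F \in feasible D); rewrite //= (feasible_ground FD).
  rewrite -(setD1K eX0); apply: (minor_on_contract (Z := X)) => //.
  - apply: IHn; first by rewrite (cardsD1 e X0) eX0 in lt.
    by apply: subset_trans X0X; apply: subsetDl.
  - by rewrite !inE eqxx /= (subsetP XE) // (subsetP X0X).
  - by apply: subset_trans X0X; apply: subsetDl.
  - exact: (subsetP X0X).
have mY (W : {set T}) : W \subset ground D :\: Y -> minor_on D X (ground D :\: W).
  have [n] := ubnP #|W|; elim: n W => // n IHn W lt WY.
  have [->|[e eW]] := set_0Vmem W; first by rewrite setD0; apply: mX.
  have /setDP[eE eY] := subsetP WY e eW.
  have W'Y : W :\ e \subset ground D :\: Y by apply: subset_trans WY; apply: subsetDl.
  rewrite -(setD1K eW) setUC -setDDl; apply: (minor_on_delete (Z := Y)) => //.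
  - by apply: IHn; first by rewrite (cardsD1 e W) eW in lt.
  - by rewrite !inE eqxx eE /= andbT; apply: contra eY; apply: (subsetP XY).
  - rewrite subsetD YE disjoint_sym; move: W'Y; rewrite subsetD => /andP[_].
    by [].
have := mY _ (subxx _); rewrite setDDr setDv set0U; congr minor_on.
exact: (setIidPr YE).
Qed.

End MinorClosed.

Section Isomorphism.
Variables T U : finType.

Lemma level_closed_iso (S : setsys T) (S' : setsys U) :
  isomorphic S S' -> level_closed (feasible S) -> level_closed (feasible S').
Proof.
case=> phi [psi phiK psiK] phiP lcS A Z.
pose sub (B : {set U}) : {set {y : U | y \in ground S'}} := [set y | val y \in B].
have subK (B : {set U}) : B \subset ground S' -> val @: sub B = B.
  move=> BE; apply/setP=> y; apply/imsetP/idP=> [[z]|yB]; first by rewrite inE => ? ->.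
  by exists (Sub y (subsetP BE y yB)); rewrite ?inE.
pose pull B := val @: (psi @: sub B).
have pullP (B : {set U}) : B \subset ground S' -> (pull B \in feasible S) <-> (B \in feasible S').
  move=> BE; rewrite phiP; have -> : phi @: (psi @: sub B) = sub B; last by rewrite subK.
  by rewrite -imset_comp -[RHS]imset_id; apply: eq_imset => y /=; rewrite psiK.
have pull_card (B : {set U}) : B \subset ground S' -> #|pull B| = #|B|.
  move=> BE; rewrite card_imset; last exact: val_inj.
  rewrite card_imset; last exact: can_inj psiK.
  by rewrite -{2}(subK B BE) card_imset //; apply: val_inj.
have pullS (B C : {set U}) : B \subset C -> pull B \subset pull C.
  move=> /subsetP BC; do 2!apply: imsetS.
  by apply/subsetP=> y; rewrite !inE; apply: BC.
case/andP=> /spanningP[X XS XA] /extendableP[Y YS AY] ZS cA.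
have YE := feasible_ground YS; have AE := subset_trans AY YE.
apply/(pullP _ AE); apply: (lcS (pull A) (pull Z)).
- apply/andP; split.
    apply/spanningP; exists (pull X); last exact: pullS.
    by apply/pullP => //; apply: feasible_ground.
  by apply/extendableP; exists (pull Y); [apply/pullP | apply: pullS].
- by apply/pullP => //; apply: feasible_ground.
- by rewrite !pull_card // feasible_ground.
Qed.

Lemma isomorphic_of_injection (S : setsys T) (S' : setsys U) (f : U -> T) :
    {in ground S' &, injective f} -> ground S = f @: ground S' ->
    (forall A : {set U}, A \subset ground S' -> (A \in feasible S') = (f @: A \in feasible S)) ->
  isomorphic S S'.
Proof.
move=> f_inj gS fS.
have gf (y : {y : U | y \in ground S'}) : f (val y) \in ground S.
  by rewrite gS imset_f //; apply: valP.
pose psi y : {x : T | x \in ground S} := Sub (f (val y)) (gf y).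
have psi_inj : injective psi.
  by move=> y z /(congr1 val) /= /f_inj E; apply/val_inj/E; apply: valP.
have [|phi psiK phiK] := inj_card_bij psi_inj.
  by rewrite !card_sig gS -(card_in_imset f_inj).
exists phi; first by exists psi.
move=> A; have {1}-> : A = psi @: (phi @: A).
  by rewrite -imset_comp -[LHS]imset_id; apply: eq_imset => x /=; rewrite phiK.
rewrite fS; last by apply/subsetP=> _ /imsetP[y _ ->]; apply: valP.
by rewrite -!imset_comp.
Qed.

End Isomorphism.

(** All seven excluded systems have the empty set and the ground set feasible. This makes both ends
    of the interval above [X] feasible in [D], as [minor_on_feasible] demands. *)
Lemma has_minor_iso_on (T U : finType) (D : setsys T) (S : setsys U) (f : U -> T) (X : {set T}) :
    {in ground S &, injective f} -> [disjoint X & f @: ground S] ->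
    set0 \in feasible S -> ground S \in feasible S ->
    (forall A : {set U}, A \subset ground S ->
       (A \in feasible S) = (X :|: f @: A \in feasible D)) ->
  has_minor_iso D S.
Proof.
move=> f_inj dX S0 SE fS.
have XD : X \in feasible D by rewrite -(setU0 X) -(imset0 f) -fS ?sub0set.
have YD : X :|: f @: ground S \in feasible D by rewrite -fS.
have [S' [mS' gS' fS']] := minor_on_feasible XD YD (subsetUl _ _).
have E : (X :|: f @: ground S) :\: X = f @: ground S.
  by rewrite setDUl setDv set0U; apply/setDidPl; rewrite disjoint_sym.
exists S' => //; apply: isomorphic_of_injection f_inj _ _; first by rewrite gS' E.
by move=> A AE; rewrite fS' E imsetS //= fS.
Qed.

Lemma level_closed_minor_iso (T U : finType) (D : setsys T) (S : setsys U) :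
  level_closed (feasible D) -> has_minor_iso D S -> level_closed (feasible S).
Proof.
by move=> lc [S' mS' iS']; apply: level_closed_iso iS' _; apply: level_closed_minor mS' lc.
Qed.

(** * Failure of level closure in the seven excluded systems *)

Section Obstructions.
Implicit Types (A B Z : {set 'I_4}) (S : setsys 'I_4).

Lemma ord4P (i : 'I_4) : [\/ i = a, i = b, i = c | i = d].
Proof.
by case: i => [[|[|[|[|n]]]] Hi] //; [apply: Or41|apply: Or42|apply: Or43|apply: Or44]; apply: val_inj.
Qed.

Lemma set4_eqE A B : (A == B) =
  [&& (a \in A) == (a \in B), (b \in A) == (b \in B),
      (c \in A) == (c \in B) & (d \in A) == (d \in B)].
Proof.
apply/eqP/and4P=> [->//|[/eqP ha /eqP hb /eqP hc /eqP hd]].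
by apply/setP=> i; case: (ord4P i) => ->.
Qed.

(** With the empty set and the ground set feasible, every subset is between, so two sets of equal
    size, one feasible and one not, suffice. *)
Lemma not_level_closed S A Z :
    set0 \in feasible S -> ground S \in feasible S -> A \subset ground S ->
    Z \in feasible S -> #|Z| = #|A| -> A \notin feasible S ->
  ~ level_closed (feasible S).
Proof.
move=> S0 SE AE ZS cA /negP AS /(_ A Z) lc; case: AS; apply: lc => //.
apply/andP; split; first by apply/spanningP; exists set0; rewrite ?sub0set.
by apply/extendableP; exists (ground S).
Qed.

Lemma U1_not_level_closed : ~ level_closed (feasible U1).
Proof.
apply: (@not_level_closed _ [set b] [set a]); rewrite ?cards1 // ?sub1set ?inE ?set4_eqE ?inE //.
Qed.

Lemma U2_not_level_closed : ~ level_closed (feasible U2).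
Proof.
apply: (@not_level_closed _ [set a] [set c]); rewrite ?cards1 // ?sub1set ?inE ?set4_eqE ?inE //.
Qed.

Lemma U3_not_level_closed : ~ level_closed (feasible U3).
Proof.
apply: (@not_level_closed _ [set a; c] [set a; b]); rewrite ?cards2 // ?subsetT // ?inE ?set4_eqE ?inE //.
Qed.

Lemma U4_not_level_closed : ~ level_closed (feasible U4).
Proof.
apply: (@not_level_closed _ [set a; c] [set a; b]); rewrite ?cards2 // ?subsetT // ?inE ?set4_eqE ?inE //.
Qed.

Lemma U5_not_level_closed : ~ level_closed (feasible U5).
Proof.
apply: (@not_level_closed _ [set a; c] [set a; b]); rewrite ?cards2 // ?subsetT // ?inE ?set4_eqE ?inE //.
Qed.

Lemma U6_not_level_closed : ~ level_closed (feasible U6).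
Proof.
apply: (@not_level_closed _ [set b; d] [set a; b]); rewrite ?cards2 // ?subsetT // ?inE ?set4_eqE ?inE //.
Qed.

Lemma U7_not_level_closed : ~ level_closed (feasible U7).
Proof.
apply: (@not_level_closed _ [set b; d] [set a; b]); rewrite ?cards2 // ?subsetT // ?inE ?set4_eqE ?inE //.
Qed.

End Obstructions.

(** * Excluded minors *)

Ltac same_elements :=
  let t := fresh "t" in move=> t; rewrite !inE;
  repeat match goal with |- context [t == ?u] => case: (t == u) => //= end.

Ltac graph_case A F :=
  rewrite !F !inE ?set4_eqE ?inE;
  by case: (a \in A); case: (b \in A); case: (c \in A); case: (d \in A).

Section Cubes.
Variables (T : finType) (D : setsys T).
Hypothesis dmD : delta_matroid D.
Implicit Types (B X : {set T}) (s e : seq T).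

Let exD : exchange (feasible D). Proof. exact: dmD.2. Qed.

(** A point of the cube above [B]. Lists make the points comparable by [=i] and let [mask] enumerate
    them. *)
Definition feas B s : bool := B :|: [set y in s] \in feasible D.

Lemma eq_feas B s s' : s =i s' -> feas B s = feas B s'.
Proof.
move=> ss'; rewrite /feas; apply: (congr1 (fun X => X \in feasible D)).
by apply/setP=> t; rewrite !inE ss'.
Qed.

Lemma feasC B p q : feas B [:: p; q] = feas B [:: q; p].
Proof. by apply: eq_feas; same_elements. Qed.

Lemma feas_cat B s s' : feas (B :|: [set y in s]) s' = feas B (s ++ s').
Proof.
rewrite /feas -setUA; apply: (congr1 (fun X => B :|: X \in feasible D)).
by apply/setP=> t; rewrite !inE mem_cat.
Qed.

Lemma feas_setD1 B w s : w \in B -> feas B s = feas (B :\ w) (w :: s).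
Proof.
move=> wB; rewrite /feas; apply: (congr1 (fun X => X \in feasible D)); apply/setP=> t; rewrite !inE.
by case: eqVneq => [->|]; rewrite ?wB.
Qed.

Lemma feas_nil B : feas B [::] = (B \in feasible D).
Proof.
by rewrite /feas; apply: (congr1 (fun X => X \in feasible D)); apply/setP=> t; rewrite !inE orbF.
Qed.

(** Exchange at the bottom of the cube, aimed at its top, never leaves the cube. The choice [q = p]
    is possible and means that the singleton of [p] is feasible. *)
Lemma feas_lower B e p :
    {in e, forall y, y \notin B} -> feas B [::] -> feas B e -> p \in e ->
  has (fun q => feas B [:: p; q]) e.
Proof.
move=> eB B0 Be pe; have [|v] := exD B0 Be (u := p).
  by rewrite in_symdiff !inE pe orbF orbT (negPf (eB p pe)).
rewrite in_symdiff !inE orbF => Bv vD.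
have vB : v \notin B by apply: contraL Bv => ->.
rewrite (negPf vB) /= in Bv; apply/hasP; exists v => //.
suff E : symdiff (B :|: [set y in [::]]) [set p; v] = B :|: [set y in [:: p; v]] by rewrite /feas -E.
apply/setP=> t; rewrite in_symdiff !inE orbF.
case: (eqVneq t p) => [->|_] /=; first by rewrite (negPf (eB p pe)).
by case: (eqVneq t v) => [->|_]; rewrite ?(negPf vB) // addbF orbF.
Qed.

Lemma feas_upper B e p :
    {in e, forall y, y \notin B} -> feas B [::] -> feas B e -> p \in e ->
  has (fun q => feas B [seq y <- e | y \notin [:: p; q]]) e.
Proof.
move=> eB B0 Be pe; have [|v] := exD Be B0 (u := p).
  by rewrite in_symdiff !inE pe orbF orbT (negPf (eB p pe)).
rewrite in_symdiff !inE orbF => Bv vD.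
have vB : v \notin B by apply: contraL Bv => ->.
rewrite (negPf vB) /= addbF in Bv; apply/hasP; exists v => //.
suff E : symdiff (B :|: [set y in e]) [set p; v] = B :|: [set y in [seq y <- e | y \notin [:: p; v]]].
  by rewrite /feas -E.
apply/setP=> t; rewrite in_symdiff !inE mem_filter !inE.
case: (eqVneq t p) => [->|_] /=; first by rewrite (negPf (eB p pe)) pe.
by case: (eqVneq t v) => [->|_]; rewrite ?(negPf vB) ?Bv //= addbF.
Qed.

(** The ordinals number the entries of the list. Its head [x0] is the default value of [nth] for
    ordinals outside the ground set, where the map need not be injective. *)
Lemma has_minor_iso_table (S : setsys 'I_4) B x0 e :
    let e := x0 :: e in
    uniq e -> size e <= 4 -> ground S = [set i : 'I_4 | i < size e] ->
    {in e, forall y, y \notin B} -> set0 \in feasible S -> ground S \in feasible S ->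
    (forall A : {set 'I_4}, A \subset ground S ->
      (A \in feasible S) = feas B (mask [:: a \in A; b \in A; c \in A; d \in A] e)) ->
  has_minor_iso D S.
Proof.
move: (x0 :: e) => {}e /= ue le4 gS eB S0 SE fS.
have lt i : i \in ground S -> i < size e by rewrite gS inE.
apply: (@has_minor_iso_on _ _ _ _ (fun i : 'I_4 => nth x0 e i) B) => //.
- by move=> i j /lt li /lt lj /eqP; rewrite nth_uniq // => /eqP/val_inj.
- rewrite disjoint_sym disjoint_subset; apply/subsetP=> _ /imsetP[i /lt li ->].
  by rewrite inE eB // mem_nth.
move=> A AE; rewrite fS // /feas; apply: (congr1 (fun X => B :|: X \in feasible D)); apply/setP=> y.
have nthA (i : 'I_4) : nth false [:: a \in A; b \in A; c \in A; d \in A] i = (i \in A).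
  by case: (ord4P i) => ->.
rewrite inE in_mask //; apply/andP/imsetP=> [[ye iy]|[i iA ->]].
  have l4 : index y e < 4 by apply: leq_trans le4; rewrite index_mem.
  by exists (Ordinal l4); rewrite ?nth_index // -nthA.
have li := lt i (subsetP AE i iA).
by rewrite mem_nth // index_uniq // nthA.
Qed.

Lemma U1_minor B s p q :
    uniq [:: p, q & s] -> {in [:: p, q & s], forall y, y \notin B} ->
    feas B s -> feas B (p :: s) -> feas B [:: p, q & s] -> ~~ feas B (q :: s) ->
  has_minor_iso D U1.
Proof.
rewrite /= inE negb_or => /and3P[/andP[pq ps] qs us] eB f0 fp fpq /negPf fq.
have F s' : feas (B :|: [set y in s]) s' = feas B (s' ++ s).
  by rewrite feas_cat; apply: eq_feas => t; rewrite !mem_cat orbC.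
apply: (@has_minor_iso_table U1 (B :|: [set y in s]) p [:: q]) => //=.
- by rewrite inE pq.
- by apply/setP=> i; rewrite !inE; case: (ord4P i) => ->.
- by move=> y; rewrite !inE negb_or => /orP[]/eqP->; rewrite ?ps ?qs eB // !inE eqxx ?orbT.
- by rewrite !inE eqxx.
- by rewrite !inE eqxx ?orbT.
move=> A /subsetP AE.
have /negPf Ac : c \notin A by apply/negP=> /AE; rewrite !inE.
have /negPf Ad : d \notin A by apply/negP=> /AE; rewrite !inE.
rewrite F !inE !set4_eqE !inE Ac Ad /=.
by case: (a \in A); case: (b \in A); rewrite /= ?f0 ?fp ?fq ?fpq.
Qed.

Lemma U2_minor B p q r :
    uniq [:: p; q; r] -> {in [:: p; q; r], forall y, y \notin B} ->
    feas B [::] -> feas B [:: r] -> feas B [:: p; q] -> feas B [:: p; q; r] ->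
    ~~ feas B [:: p] -> ~~ feas B [:: q] -> ~~ feas B [:: p; r] -> ~~ feas B [:: q; r] ->
  has_minor_iso D U2.
Proof.
move=> ue eB f0 fr fpq fpqr /negPf fp /negPf fq /negPf fpr /negPf fqr.
apply: (@has_minor_iso_table U2 B p [:: q; r]) => //=.
- by apply/setP=> i; rewrite !inE; case: (ord4P i) => ->.
- by rewrite !inE eqxx.
- by rewrite !inE eqxx ?orbT.
move=> A /subsetP AE.
have /negPf Ad : d \notin A by apply/negP=> /AE; rewrite !inE.
rewrite !inE !set4_eqE !inE Ad /=.
by case: (a \in A); case: (b \in A); case: (c \in A);
  rewrite /= ?f0 ?fp ?fq ?fpq ?fr ?fpr ?fqr ?fpqr.
Qed.

(* The membership of [A] in a system with feasible sets the empty set, the whole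
   ground set, and the 2-sets flagged by [gpq], ..., [grs]. *)
Definition graph_table (gpq gpr gps gqr gqs grs pA qA rA sA : bool) : bool :=
  match pA, qA, rA, sA with
  | true, true, false, false => gpq
  | true, false, true, false => gpr
  | true, false, false, true => gps
  | false, true, true, false => gqr
  | false, true, false, true => gqs
  | false, false, true, true => grs
  | false, false, false, false | true, true, true, true => true
  | _, _, _, _ => false
  end.

(** The cube is given by a fixed list [e], whereas [p], [q], [r], [s] reorder it to match the labels
    [a], [b], [c], [d] of [S]; one set of hypotheses thus serves every labelling. *)
Lemma graph_minor (S : setsys 'I_4) B e (p q r s : T) :
    uniq [:: p; q; r; s] -> [:: p; q; r; s] =i e -> {in e, forall y, y \notin B} ->
    feas B [::] -> feas B e -> {in e, forall y, ~~ feas B [:: y]} ->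
    {in e, forall y, ~~ feas B [seq v <- e | v != y]} ->
    ground S = setT ->
    (forall A : {set 'I_4}, (A \in feasible S) =
       graph_table (feas B [:: p; q]) (feas B [:: p; r]) (feas B [:: p; s])
         (feas B [:: q; r]) (feas B [:: q; s]) (feas B [:: r; s])
         (a \in A) (b \in A) (c \in A) (d \in A)) ->
  has_minor_iso D S.
Proof.
move=> ue pe eB f0 fe h1 h3 gS fS.
apply: (@has_minor_iso_table S B p [:: q; r; s]) => //.
- by rewrite gS; apply/setP=> i; rewrite !inE; case: (ord4P i) => ->.
- by move=> y; rewrite pe; apply: eB.
- by rewrite fS !inE.
- by rewrite fS gS !inE.
move=> A _; rewrite fS.
have g1 y : y \in [:: p; q; r; s] -> feas B [:: y] = false.
  by rewrite pe => /h1/negPf.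
have g3 y : y \in [:: p; q; r; s] -> feas B [seq v <- [:: p; q; r; s] | v != y] = false.
  rewrite pe => /h3/negPf <-; apply: eq_feas => v.
  by rewrite !mem_filter pe.
have fe' : feas B [:: p; q; r; s] by rewrite (eq_feas _ pe).
have := g3 p; have := g3 q; have := g3 r; have := g3 s; move: ue.
rewrite /= !inE !negb_or => /and4P[/and3P[pq pr ps] /andP[qr qs] rs _].
rewrite !eqxx ![q == p]eq_sym ![r == p]eq_sym ![s == p]eq_sym ![r == q]eq_sym.
rewrite ![s == q]eq_sym ![s == r]eq_sym pq pr ps qr qs rs /= ?orbT.
move=> /(_ isT) t1 /(_ isT) t2 /(_ isT) t3 /(_ isT) t4.
by case: (a \in A); case: (b \in A); case: (c \in A); case: (d \in A);
  rewrite /= ?f0 ?fe' ?t1 ?t2 ?t3 ?t4 ?g1 // !inE eqxx ?orbT.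
Qed.

(** Each of [xz], [w], [zw], if feasible, produces [U1]; for [w] this uses that exchange at [x] from
    the bottom makes [xw] feasible once [x] and [xz] are not. If none is, the feasible sets are the
    empty set, [z], [xw] and [xzw], which is [U2] with [z] as [c]. *)
Lemma U1_U2_of_lower B x z w :
    uniq [:: x; z; w] -> {in [:: x; z; w], forall y, y \notin B} ->
    feas B [::] -> feas B [:: z] -> feas B [:: x; z; w] -> ~~ feas B [:: x] ->
  has_minor_iso D U1 \/ has_minor_iso D U2.
Proof.
move=> ue eB f0 fz fxzw fx.
have /= := ue; rewrite !inE negb_or => /and3P[/andP[xz xw] zw _].
have xB : x \notin B by rewrite eB // !inE eqxx.
have zB : z \notin B by rewrite eB // !inE eqxx ?orbT.
have wB : w \notin B by rewrite eB // !inE eqxx ?orbT.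
have [fzx|fzx] := boolP (feas B [:: z; x]).
  left; apply: (@U1_minor B [::] z x) => //=; first by rewrite inE eq_sym xz.
  by move=> y; rewrite !inE => /orP[]/eqP->.
have fxw : feas B [:: x; w].
  have := feas_lower eB f0 fxzw (p := x); rewrite inE eqxx /= orbF => /(_ isT).
  rewrite (eq_feas _ (_ : [:: x; x] =i [:: x])); last by same_elements.
  by rewrite (negPf fx) feasC (negPf fzx).
have [fw|fw] := boolP (feas B [:: w]).
  left; apply: (@U1_minor B [::] w x) => //=; first by rewrite inE eq_sym xw.
    by move=> y; rewrite !inE => /orP[]/eqP->.
  by rewrite feasC.
have [fzw|fzw] := boolP (feas B [:: z; w]).
  left; apply: (@U1_minor B [::] z w) => //=; first by rewrite inE zw.
  by move=> y; rewrite !inE => /orP[]/eqP->.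
right; apply: (@U2_minor B x w z) => //=.
- by rewrite !inE negb_or xw xz eq_sym zw.
- by move=> y; rewrite !inE => /or3P[]/eqP->.
- by rewrite (eq_feas _ (_ : _ =i [:: x; z; w])) //; same_elements.
- by rewrite feasC.
- by rewrite feasC.
Qed.

(** Complementation in the cube, with [x] and [z] interchanged, carries this to [U1_U2_of_lower];
    [U1] and [U2] are isomorphic to their duals. *)
Lemma U1_U2_of_upper B x z w :
    uniq [:: x; z; w] -> {in [:: x; z; w], forall y, y \notin B} ->
    feas B [::] -> feas B [:: z; w] -> feas B [:: x; z; w] -> ~~ feas B [:: x; w] ->
  has_minor_iso D U1 \/ has_minor_iso D U2.
Proof.
move=> ue eB f0 fzw fxzw fxw.
have /= := ue; rewrite !inE negb_or => /and3P[/andP[xz xw] zw _].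
have xB : x \notin B by rewrite eB // !inE eqxx.
have zB : z \notin B by rewrite eB // !inE eqxx ?orbT.
have wB : w \notin B by rewrite eB // !inE eqxx ?orbT.
have perm3 p q r : [:: p; q; r] =i [:: x; z; w] -> feas B [:: p; q; r] by move=> E; rewrite (eq_feas _ E).
have u3 p q r : p != q -> p != r -> q != r -> uniq [:: p; q; r].
  by move=> pq pr qr; rewrite /= !inE negb_or pq pr qr.
have in3 p q r : p \notin B -> q \notin B -> r \notin B -> {in [:: p; q; r], forall y, y \notin B}.
  by move=> pB qB rB y; rewrite !inE => /or3P[]/eqP->.
have [zx wx wz] : [/\ z != x, w != x & w != z] by rewrite ![_ == x]eq_sym [w == z]eq_sym.
have [fw|fw] := boolP (feas B [:: w]).
  left; apply: (@U1_minor B [:: w] z x); rewrite ?u3 //; first exact: in3.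
  by apply: perm3; same_elements.
have fx : feas B [:: x].
  have := feas_upper eB f0 fxzw (p := z); rewrite !inE eqxx orbT /= => /(_ isT).
  rewrite !inE !eqxx (negPf xz) (negPf xw) (negPf zx) (negPf wx) (negPf wz) (negPf zw) /=.
  by rewrite !orbF (negPf fw) (negPf fxw).
have [fxz|fxz] := boolP (feas B [:: x; z]).
  left; apply: (@U1_minor B [:: x] z w); rewrite ?u3 //.
  - exact: in3.
  - by rewrite feasC.
  - by apply: perm3; same_elements.
  - by rewrite feasC.
have [fz|fz] := boolP (feas B [:: z]).
  left; apply: (@U1_minor B [:: z] w x); rewrite ?u3 //.
  - exact: in3.
  - by rewrite feasC.
  - by apply: perm3; same_elements.
right; apply: (@U2_minor B z w x); rewrite ?u3 //.
- exact: in3.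
- by apply: perm3; same_elements.
- by rewrite feasC.
- by rewrite feasC.
Qed.

(** The partner of [z] is [z] itself, an element of [B], or [x]; the last would make [B + x]
    feasible. *)
Lemma feas_step_down B x z :
    x \notin B -> z \notin B -> x != z -> feas B [:: z] -> ~~ feas B [:: x] ->
    spanning (feasible D) (x |: B) ->
  feas B [::] \/ exists2 w, w \in B & feas (B :\ w) [::].
Proof.
move=> xB zB xz fz fx /spanningP[X XD /subsetP XxB].
have zX : z \notin X.
  by apply/negP=> /XxB; rewrite !inE (negPf zB) eq_sym (negPf xz).
have [|v] := exD fz XD (u := z); first by rewrite in_symdiff !inE eqxx orbT (negPf zX).
rewrite in_symdiff !inE => Bv vD.
have [vz|vz] := eqVneq v z.
  left; rewrite feas_nil; suff <- : symdiff (B :|: [set y in [:: z]]) [set z; v] = B by [].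
  apply/setP=> t; rewrite in_symdiff !inE vz orbb.
  by case: eqVneq => [->|_]; rewrite ?(negPf zB) // orbF addbF.
rewrite (negPf vz) orbF in Bv; have [vB|vB] := boolP (v \in B).
  right; exists v => //; rewrite feas_nil.
  rewrite /feas; suff <- : symdiff (B :|: [set y in [:: z]]) [set z; v] = B :\ v by [].
  apply/setP=> t; rewrite in_symdiff !inE.
  case: (eqVneq t z) => [->|_] /=; first by rewrite (negPf zB) andbF.
  by case: (eqVneq t v) => [->|_]; rewrite ?vB // orbF addbF.
case/negP: fx; rewrite (negPf vB) /= in Bv.
have vx : v = x by have := XxB v Bv; rewrite !inE (negPf vB) orbF => /eqP.
rewrite /feas; suff <- : symdiff (B :|: [set y in [:: z]]) [set z; v] = B :|: [set y in [:: x]] by [].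
apply/setP=> t; rewrite in_symdiff !inE vx.
case: (eqVneq t z) => [->|_] /=; first by rewrite (negPf zB) eq_sym (negPf xz).
by case: (eqVneq t x) => [->|_]; rewrite ?(negPf xB) // addbF orbF.
Qed.

Lemma feas_step_up B x z :
    x \notin B -> z \notin B -> x != z -> feas B [:: z] -> ~~ feas B [:: x] ->
    extendable (feasible D) (x |: B) ->
  feas B [:: x; z] \/
  exists y, [/\ y \notin B, y != x, y != z & feas B [:: x; z; y]].
Proof.
move=> xB zB xz fz fx /extendableP[Y YD xBY].
have xY : x \in Y by rewrite (subsetP xBY) // setU11.
have BY : B \subset Y by apply: subset_trans xBY; apply: subsetUr.
have [|v] := exD fz YD (u := x).
  by rewrite in_symdiff !inE (negPf xB) (negPf xz) xY.
rewrite in_symdiff !inE => Bv vD.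
have vB : v \notin B by apply/negP=> vB; rewrite vB (subsetP BY) in Bv.
have [vx|vx] := eqVneq v x.
  left; rewrite /feas; suff <- : symdiff (B :|: [set y in [:: z]]) [set x; v] = B :|: [set y in [:: x; z]] by [].
  apply/setP=> t; rewrite in_symdiff !inE vx orbb.
  case: (eqVneq t x) => [->|_]; last by rewrite addbF.
  by rewrite (negPf xB) (negPf xz).
have [vz|vz] := eqVneq v z.
  case/negP: fx.
  rewrite /feas; suff <- : symdiff (B :|: [set y in [:: z]]) [set x; v] = B :|: [set y in [:: x]] by [].
  apply/setP=> t; rewrite in_symdiff !inE vz.
  case: (eqVneq t x) => [->|_] /=; first by rewrite (negPf xB) (negPf xz).
  by case: (eqVneq t z) => [->|_]; rewrite ?(negPf zB) // addbF orbF.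
right; exists v; split=> //.
rewrite /feas; suff <- : symdiff (B :|: [set y in [:: z]]) [set x; v] = B :|: [set y in [:: x; z; v]] by [].
apply/setP=> t; rewrite in_symdiff !inE.
case: (eqVneq t x) => [->|_] /=; first by rewrite (negPf xB) (negPf xz).
case: (eqVneq t v) => [->|_] /=; first by rewrite (negPf vB) (negPf vz).
by rewrite orbF addbF.
Qed.

(** Feasibility of [B] or of [B + x + z] fixes one end of the cube, so only one of the two exchanges
    can bring in a further element, and at most three elements are involved. *)
Lemma U1_U2_of_adjacent B x z :
    x \notin B -> z \notin B -> x != z -> feas B [:: z] -> ~~ feas B [:: x] ->
    between (feasible D) (x |: B) -> feas B [::] || feas B [:: x; z] ->
  has_minor_iso D U1 \/ has_minor_iso D U2.
Proof.
move=> xB zB xz fz fx /andP[sx ex].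
have zx : z != x by rewrite eq_sym.
have [f0 _|f0 /= fxz] := boolP (feas B [::]).
  have [fxz|[y [yB yx yz fxzy]]] := feas_step_up xB zB xz fz fx ex.
    left; apply: (@U1_minor B [::] z x) => //=; first by rewrite inE zx.
      by move=> t; rewrite !inE => /orP[]/eqP->.
    by rewrite feasC.
  apply: (@U1_U2_of_lower B x z y) => //=.
    by rewrite !inE negb_or xz ![_ == y]eq_sym yx yz.
  by move=> t; rewrite !inE => /or3P[]/eqP->.
have [f0'|[w wB fw]] := feas_step_down xB zB xz fz fx sx; first by rewrite f0' in f0.
have [xw zw] : x != w /\ z != w by split; apply: contraTneq wB => <-.
apply: (@U1_U2_of_upper (B :\ w) x z w) => //=.
- by rewrite !inE negb_or xz xw zw.
- by move=> t; rewrite !inE => /or3P[]/eqP->; rewrite ?eqxx // (negPf xB, negPf zB) andbF.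
- by rewrite feasC -feas_setD1.
- rewrite (eq_feas _ (_ : _ =i [:: w; x; z])) -?feas_setD1 //; same_elements.
- by rewrite feasC -feas_setD1.
Qed.

Lemma U3_U7_of_cube B x z w y :
    let e := [:: x; z; w; y] in
    uniq e -> {in e, forall v, v \notin B} -> feas B [::] -> feas B e ->
    {in e, forall v, ~~ feas B [:: v]} ->
    {in e, forall v, ~~ feas B [seq u <- e | u != v]} ->
    feas B [:: z; w] -> ~~ feas B [:: x; w] ->
  has_minor_iso D U3 \/ has_minor_iso D U4 \/ has_minor_iso D U5 \/
  has_minor_iso D U6 \/ has_minor_iso D U7.
Proof.
move=> e ue eB f0 fe f1 f3 zwT /negPf xwF.
(* In the graph of feasible pairs, exchange at the bottom gives an edge at [x] and one at [y], and
   exchange at the top gives an edge missing [z]; the non-edge [xw] is struck from these lists. *)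
have [lx ly uz] : [/\ feas B [:: x; z] || feas B [:: x; y],
    [|| feas B [:: x; y], feas B [:: z; y] | feas B [:: w; y]]
    & feas B [:: w; y] || feas B [:: x; y]].
  have := feas_lower eB f0 fe (p := x); have := feas_lower eB f0 fe (p := y).
  have := feas_upper eB f0 fe (p := z).
  have sg v : v \in e -> feas B [:: v; v] = false.
    by move/f1/negPf<-; apply: eq_feas => t; rewrite !inE orbb.
  move: ue; rewrite /e /= !inE !negb_or !eqxx ?orbT.
  case/and4P=> /and3P[xz xw xy] /andP[zw zy] wy _.
  rewrite ![z == x]eq_sym ![w == x]eq_sym ![y == x]eq_sym ![w == z]eq_sym.
  rewrite ![y == z]eq_sym ![y == w]eq_sym.
  rewrite (negPf xz) (negPf xw) (negPf xy) (negPf zw) (negPf zy) (negPf wy) /=.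
  move=> /(_ isT) uz /(_ isT) ly /(_ isT) lx.
  have f3z : feas B [:: x; w; y] = false.
    have := f3 z; rewrite /e /= !inE !eqxx orbT xz ![_ == z]eq_sym zw zy /=.
    by move/(_ isT)/negPf.
  move: uz ly lx; rewrite !sg ?inE ?eqxx ?orbT // ![feas B [:: y; _]]feasC.
  by rewrite f3z xwF !orbF.
have G (S : setsys 'I_4) (p q r s : T) (pe : [:: p; q; r; s] =i e) :=
  @graph_minor S B e p q r s (etrans (eq_uniq (erefl : size [:: p; q; r; s] = size e) pe) ue)
    pe eB f0 fe f1 f3.
have sym p q v : feas B [:: p; q] = v -> (feas B [:: p; q] = v) * (feas B [:: q; p] = v).
  by move=> <-; rewrite [feas B [:: q; p]]feasC.
have ZW := sym _ _ _ zwT; have XW := sym _ _ _ xwF.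
(* Ten of the sixteen choices for the four undetermined pairs survive, each an isomorphic copy of
   one of the five graphs. *)
move: lx ly uz; case xy : (feas B [:: x; y]); case xz : (feas B [:: x; z]);
  case zy : (feas B [:: z; y]); case wy : (feas B [:: w; y]) => // _ _ _;
  have {xy xz zy wy}F := (ZW, XW, sym _ _ _ xy, sym _ _ _ xz, sym _ _ _ zy, sym _ _ _ wy).
- do 4!right; apply: (G U7 z x y w) => [||A]; [by same_elements | by [] | graph_case A F].
- do 3!right; left; apply: (G U6 z x y w) => [||A]; [by same_elements | by [] | graph_case A F].
- do 2!right; left; apply: (G U5 x z w y) => [||A]; [by same_elements | by [] | graph_case A F].
- right; left; apply: (G U4 y x z w) => [||A]; [by same_elements | by [] | graph_case A F].
- do 3!right; left; apply: (G U6 y z w x) => [||A]; [by same_elements | by [] | graph_case A F].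
- right; left; apply: (G U4 w z y x) => [||A]; [by same_elements | by [] | graph_case A F].
- right; left; apply: (G U4 z w y x) => [||A]; [by same_elements | by [] | graph_case A F].
- left; apply: (G U3 z w x y) => [||A]; [by same_elements | by [] | graph_case A F].
- do 3!right; left; apply: (G U6 z w y x) => [||A]; [by same_elements | by [] | graph_case A F].
- right; left; apply: (G U4 x z w y) => [||A]; [by same_elements | by [] | graph_case A F].
Qed.

Lemma U1_U7_of_adjacent B x z :
    x \notin B -> z \notin B -> x != z -> feas B [:: z] -> ~~ feas B [:: x] ->
    between (feasible D) (x |: B) ->
  has_minor_iso D U1 \/ has_minor_iso D U2 \/ has_minor_iso D U3 \/
  has_minor_iso D U4 \/ has_minor_iso D U5 \/ has_minor_iso D U6 \/ has_minor_iso D U7.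
Proof.
move=> xB zB xz fz fx bx.
have small : has_minor_iso D U1 \/ has_minor_iso D U2 -> has_minor_iso D U1 \/
    has_minor_iso D U2 \/ has_minor_iso D U3 \/ has_minor_iso D U4 \/
    has_minor_iso D U5 \/ has_minor_iso D U6 \/ has_minor_iso D U7 by tauto.
have [|] := boolP (feas B [::] || feas B [:: x; z]).
  by move=> f; apply/small/(U1_U2_of_adjacent xB zB xz fz fx bx f).
rewrite negb_or => /andP[n0 nxz]; have /andP[sx ex] := bx.
have [f0|[w wB fw]] := feas_step_down xB zB xz fz fx sx; first by rewrite f0 in n0.
have [fxz|[y [yB yx yz fxzy]]] := feas_step_up xB zB xz fz fx ex; first by rewrite fxz in nxz.
pose C := B :\ w; pose e := [:: x; z; w; y].
have BC s : feas B s = feas C (w :: s) by apply: feas_setD1.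
have [xw zw yw] : [/\ x != w, z != w & y != w] by split; apply: contraTneq wB => <-.
have ue : uniq e.
  by rewrite /= !inE !negb_or xz xw zw ![_ == y]eq_sym yx yz yw.
have eC : {in e, forall v, v \notin C}.
  by move=> v; rewrite !inE => /or4P[]/eqP->; rewrite ?eqxx // ?(negPf xB) ?(negPf zB) ?(negPf yB) andbF.
have fe : feas C e.
  by rewrite (eq_feas _ (_ : _ =i [:: w; x; z; y])) -?BC //; same_elements.
have bC (A : {set T}) : C \subset A -> A \subset C :|: [set v in e] -> between (feasible D) A.
  move=> CA Ae; apply/andP; split; first by apply/spanningP; exists C; rewrite // -feas_nil.
  by apply/extendableP; exists (C :|: [set v in e]).
(* [C + w] is [B], which is infeasible. A feasible [C + p] therefore forms with it an adjacent pair
   above the feasible set [C]. *)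
have [/allP f1|/allPn[p pe /negPn fp]] := boolP (all (fun v => ~~ feas C [:: v]) e); last first.
  have nw : ~~ feas C [:: w] by rewrite -BC.
  have pw : w != p by apply: contraTneq fp => <-.
  apply/small/(U1_U2_of_adjacent (B := C) (x := w) (z := p)) => //; rewrite ?fw //.
  - by apply: eC; rewrite !inE eqxx ?orbT.
  - exact: eC.
  - apply: bC; first exact: subsetUr.
    by apply/subsetP=> t; rewrite !inE => /orP[->|->]; rewrite ?orbT.
have [/allP f3|/allPn[p pe /negPn fp]] := boolP (all (fun v => ~~ feas C [seq u <- e | u != v]) e).
  do 2!right; apply: (@U3_U7_of_cube C x z w y) => //.
    by rewrite feasC -BC.
  by rewrite feasC -BC.
(* Dually, [e] without [y] stands for [B + x + z], which is infeasible, while [e] without [p] is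
   feasible. The two are adjacent above [C + s], and their union, the top of the cube, is
   feasible. *)
pose s := [seq u <- e | u \notin [:: p; y]].
have ny : ~~ feas C [seq u <- e | u != y].
  rewrite /e /= [x == y]eq_sym [z == y]eq_sym [w == y]eq_sym yx yz yw eqxx /=.
  by rewrite (eq_feas _ (_ : _ =i [:: w; x; z])) -?BC //; same_elements.
have py : p != y by apply: contraTneq fp => ->.
have ye : y \in e by rewrite !inE eqxx ?orbT.
have sE q r : q \in e -> q != r -> [:: q; r] =i [:: p; y] ->
    s ++ [:: q] =i [seq u <- e | u != r].
  move=> qe qr qrpy t; rewrite mem_cat !mem_filter -qrpy !inE negb_or.
  by case: (eqVneq t q) => [->|_] /=; rewrite ?orbF // qr; move: qe; rewrite !inE => ->.
apply/small/(U1_U2_of_adjacent (B := C :|: [set v in s]) (x := p) (z := y)) => //.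
- by rewrite in_setU negb_or eC //= in_set mem_filter !inE eqxx.
- by rewrite in_setU negb_or eC //= in_set mem_filter !inE eqxx orbT.
- by rewrite feas_cat (eq_feas _ (sE y p _ _ _)) // 1?eq_sym //; same_elements.
- by rewrite feas_cat (eq_feas _ (sE p y _ _ _)).
- apply: bC; first by rewrite setUCA subsetUl.
  rewrite setUCA setUS //; apply/subsetP=> t.
  case/setU1P=> [->|]; first by rewrite in_set.
  by rewrite !(in_set (fun v => v \in _)) mem_filter => /andP[].
apply/orP; right; rewrite feas_cat (eq_feas _ (_ : _ =i e)) // => t.
rewrite mem_cat mem_filter; case te: (t \in e); first by rewrite andbT orNb.
by rewrite andbF /=; apply: contraFF te; rewrite in_cons mem_seq1 => /orP[]/eqP->.
Qed.

Lemma level_closed_or_minor :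
  level_closed (feasible D) \/
  (has_minor_iso D U1 \/ has_minor_iso D U2 \/ has_minor_iso D U3 \/
   has_minor_iso D U4 \/ has_minor_iso D U5 \/ has_minor_iso D U6 \/ has_minor_iso D U7).
Proof.
pose bad A Z := [&& between (feasible D) A, Z \in feasible D, #|Z| == #|A| & A \notin feasible D].
have [/existsP[A /existsP[Z /and4P[bA ZD /eqP cZ AD]]]|nbad] := boolP [exists A, exists Z, bad A Z].
  right; have [Z' [z [x [ZD' zZ' xZ' bx nx]]]] := adjacent_obstruction exD bA ZD cZ AD.
  pose B := Z' :\ z.
  have zB : z \notin B by rewrite !inE eqxx.
  have xB : x \notin B by rewrite !inE (negPf xZ') andbF.
  have xz : x != z by apply: contraNneq xZ' => ->.
  have fz : feas B [:: z].
    rewrite /feas; suff <- : Z' = B :|: [set y in [:: z]] by [].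
    by rewrite -{1}(setD1K zZ') setUC; apply/setP=> t; rewrite !inE.
  have fx : ~~ feas B [:: x].
    apply: contra nx; rewrite /feas; suff <- : x |: B = B :|: [set y in [:: x]] by [].
    by rewrite setUC; apply/setP=> t; rewrite !inE.
  exact: (U1_U7_of_adjacent xB zB xz fz fx bx).
left=> A Z bA ZD cZ; apply: contraNT nbad => AD; apply/existsP; exists A; apply/existsP; exists Z.
by rewrite /bad bA ZD cZ eqxx.
Qed.

End Cubes.

Theorem theorem3p4 (T : finType) (D : setsys T) (hD : delta_matroid D) :
  higgs_lift_delta_matroid D <->
  ~ (has_minor_iso D U1 \/ has_minor_iso D U2 \/ has_minor_iso D U3 \/
     has_minor_iso D U4 \/ has_minor_iso D U5 \/ has_minor_iso D U6 \/
     has_minor_iso D U7).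
Proof.
split=> [/higgs_lift_level_closed lcD|noU].
  have no (S : setsys 'I_4) : ~ level_closed (feasible S) -> ~ has_minor_iso D S.
    by move=> ncS /(level_closed_minor_iso lcD).
  case=> [|[|[|[|[|[|]]]]]].
  - exact: no U1_not_level_closed.
  - exact: no U2_not_level_closed.
  - exact: no U3_not_level_closed.
  - exact: no U4_not_level_closed.
  - exact: no U5_not_level_closed.
  - exact: no U6_not_level_closed.
  - exact: no U7_not_level_closed.
by case: (level_closed_or_minor hD) => // /(level_closed_higgs_lift hD).
Qed.
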